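(* Let $\alpha\ge 0$ be fixed and, for $p>1$, let $u^1_p$ be the positive least energy radial solution of $$-\Delta u=|x|^{\alpha}|u|^{p-1}u \ \text{ in } B,\qquad u=0 \ \text{ on }\partial B .$$ Set $\mu_p=|u^1_p(0)|$, $\rho_p=(p\,\mu_p^{p-1})^{-\frac{1}{2+\alpha}}$ and $$\widetilde u_p(x)=\frac{p\,(u^1_p(\rho_p x)-u^1_p(0))}{u^1_p(0)},\qquad |x|<1/\rho_p .$$ Then, as $p\to\infty$, $\mu_p\to\sqrt e$, $\rho_p\to 0$, and $$\widetilde u_p(x)\to \log\frac{4(2+\alpha)^4}{\big(2(2+\alpha)^2+|x|^{2+\alpha}\big)^2}\quad\text{in } C^1_{\mathrm{loc}}(\mathbb R^2).$$
   Context: $B$ is the open unit disc of $\mathbb R^2$ centred at the origin. A least energy radial solution is a minimizer of the energy $\mathcal E(u)=\frac12\int_B|\nabla u|^2-\frac1{p+1}\int_B|x|^\alpha|u|^{p+1}$ on the radial Nehari set $\{v\in H^1_{0}(B)\text{ radial},\ v\neq0,\ \int_B|\nabla v|^2=\int_B|x|^\alpha|v|^{p+1}\}$; it is a classical solution, unique up to sign, and $u^1_p$ denotes the positive one (its only critical point is the origin, where it attains its maximum). *)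

(* Defs.v *)
From Stdlib Require Import Reals Lra.
Open Scope R_scope.

(* |r|^b for r >= 0 and b > 0, with the convention 0^b = 0
   (Stdlib's Rpower 0 b would give 1). *)
Definition rpow (r b : R) : R := if Rle_dec r 0 then 0 else Rpower r b.

Definition normR2 (x y : R) : R := sqrt (x * x + y * y).

Definition RInt_eq (f : R -> R) (a b I : R) : Prop :=
  exists pr : Riemann_integrable f a b, RiemannInt pr = I.

(* A radial function u(x) = v(|x|) on the unit disc B, with profile v of class
   C^1 on [0,1] (derivative v'), vanishing on the boundary (v 1 = 0).
   Such u belong to the radial part of H^1_0(B), and they are dense in it. *)
Definition radial_profile (v v' : R -> R) : Prop :=
  (forall r, 0 <= r <= 1 -> derivable_pt_lim v r (v' r) /\ continuity_pt v' r)
  /\ v 1 = 0.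

(* In polar coordinates: int_B |grad u|^2 = 2 pi int_0^1 v'(r)^2 r dr,
   int_B |x|^alpha |u|^(p+1) = 2 pi int_0^1 r^alpha |v(r)|^(p+1) r dr. *)
Definition grad_density (v' : R -> R) : R -> R := fun r => (v' r) ^ 2 * r.
Definition pot_density (alpha p : R) (v : R -> R) : R -> R :=
  fun r => rpow r alpha * rpow (Rabs (v r)) (p + 1) * r.

Definition radial_energy (alpha p : R) (v v' : R -> R) (E : R) : Prop :=
  exists G P, RInt_eq (grad_density v') 0 1 G /\ RInt_eq (pot_density alpha p v) 0 1 P
    /\ E = 2 * PI * (G / 2 - P / (p + 1)).

Definition in_radial_nehari (alpha p : R) (v v' : R -> R) : Prop :=
  (exists r, 0 <= r <= 1 /\ v r <> 0) /\
  exists G, RInt_eq (grad_density v') 0 1 G /\ RInt_eq (pot_density alpha p v) 0 1 G.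

Definition least_energy_radial (alpha p : R) (v : R -> R) : Prop :=
  exists v', radial_profile v v' /\ in_radial_nehari alpha p v v' /\
  forall w w', radial_profile w w' -> in_radial_nehari alpha p w w' ->
    forall Ev Ew, radial_energy alpha p v v' Ev -> radial_energy alpha p w w' Ew ->
      Ev <= Ew.

Definition pos_least_energy_radial (alpha p : R) (v : R -> R) : Prop :=
  least_energy_radial alpha p v /\ (forall r, 0 <= r < 1 -> v r > 0).

Definition mu (v : R -> R) : R := Rabs (v 0).
Definition rho (alpha p : R) (v : R -> R) : R :=
  Rpower (p * Rpower (mu v) (p - 1)) (- (1 / (2 + alpha))).

Definition utilde (alpha p : R) (v : R -> R) (x y : R) : R :=
  p * (v (rho alpha p v * normR2 x y) - v 0) / v 0.

Definition Ulim (alpha x y : R) : R :=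
  ln (4 * (2 + alpha) ^ 4 / (2 * (2 + alpha) ^ 2 + rpow (normR2 x y) (2 + alpha)) ^ 2).

Definition C1loc_conv_infty (dom : R -> R -> R -> Prop)
  (f : R -> R -> R -> R) (g : R -> R -> R) : Prop :=
  forall Rad eps, 0 < Rad -> 0 < eps -> exists P, forall p, p > P ->
    forall x y, x * x + y * y <= Rad * Rad ->
      dom p x y /\
      Rabs (f p x y - g x y) < eps /\
      (exists a b, derivable_pt_lim (fun t => f p t y) x a /\
                   derivable_pt_lim (fun t => g t y) x b /\ Rabs (a - b) < eps) /\
      (exists a b, derivable_pt_lim (fun t => f p x t) y a /\
                   derivable_pt_lim (fun t => g x t) y b /\ Rabs (a - b) < eps).

(* Main.v *)
(** A minimizer on the Nehari set minimizes the scale-invariant quotient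
    [(int v'^2 r)^(p+1) / (int r^(1+alpha) |v|^(p+1))^2]; a first variation and the
    du Bois-Reymond argument give the radial equation [(r v')' = - r^(1+alpha) v^p].
    From there on minimality plays no role. The rescaled function [z] solves
    [(r z')' = - r^(1+alpha) (1 + z/p)^p], [z(0) = z'(0) = 0], up to [S = 1/rho], where
    [z(S) = - p]. The nonlinearity is at most 1, so [z >= - r^(2+alpha) / (2+alpha)^2] and
    [S -> oo]. As [(1 + z/p)^p -> e^z] locally uniformly, Gronwall's lemma gives [z -> U] in
    C^1_loc, where [U] solves the Liouville equation. A Pohozaev identity gives
    [- r z' <= 2 (2+alpha)], while [- T z'(T)] is close to [2 (2+alpha)] for [T] and [p] large;
    integrating [- z'] up to [S] yields [(2+alpha) ln S = p/2 + o(p)]. Since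
    [S^(2+alpha) = p mu^(p-1)] this says [ln mu -> 1/2]. *)

Require Import Defs.
From Stdlib Require Import Reals Lra Psatz Classical.
From Coquelicot Require Import Coquelicot.
Open Scope R_scope.

(** * Powers *)

(** Local convergence to [U] alone does not reach [mu]: the boundary condition sits at [S], and
    [ln S] is of order [p], far outside every compact set on which [z] is close to [U]. On the long
    interval [[T, S]] only the flux [r z'] is controlled, and this suffices. Being nonincreasing, it
    stays below its value at one fixed [T], which is read off from [U]; the Pohozaev bound keeps it
    above [- 2 (2+alpha)], which is exactly minus the total mass of [U], so the two bounds meet in
    the limit. Hence [z] falls like [- 2 (2+alpha) ln r] up to [S], and the limit [1/2] is the ratio
    of [2+alpha], from the exponent of [S], to [2 (2+alpha)]; this is why it does not depend on
    [alpha]. The other obstacle is regularity. Profiles are only C^1, so the second derivative has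
    to come out of minimality, and every test function must be a C^1 profile vanishing at 1. *)

Lemma rpow_Rpower (r b : R) : 0 < r -> rpow r b = Rpower r b.
Proof. intros Hr. unfold rpow. destruct (Rle_dec r 0); [lra | reflexivity]. Qed.

Lemma rpow_nonpos (r b : R) : r <= 0 -> rpow r b = 0.
Proof. intros Hr. unfold rpow. destruct (Rle_dec r 0); [reflexivity | lra]. Qed.

Lemma Rpower_gt0 (x b : R) : 0 < Rpower x b.
Proof. apply exp_pos. Qed.

Lemma rpow_ge0 (r b : R) : 0 <= rpow r b.
Proof.
  unfold rpow. destruct (Rle_dec r 0); [lra |]. left; apply Rpower_gt0.
Qed.

Lemma Rpower_S (x b : R) : 0 < x -> Rpower x (b + 1) = Rpower x b * x.
Proof. intros Hx. rewrite Rpower_plus, Rpower_1; auto. Qed.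

Lemma rpow_S (r b : R) : rpow r (b + 1) = rpow r b * r.
Proof.
  unfold rpow. destruct (Rle_dec r 0); [ring |]. apply Rpower_S; lra.
Qed.

Lemma rpow_mult (t x b : R) : 0 < t -> rpow (t * x) b = Rpower t b * rpow x b.
Proof.
  intros Ht. destruct (Rle_dec x 0) as [Hx | Hx].
  - rewrite (rpow_nonpos x), rpow_nonpos; [ring | nra | auto].
  - rewrite !rpow_Rpower; [symmetry; apply Rpower_mult_distr | | ]; nra.
Qed.

Lemma Rpower_le1 (x b : R) : 0 < x <= 1 -> 0 <= b -> Rpower x b <= 1.
Proof.
  intros Hx Hb. rewrite <- (Rpower_O x) by lra.
  unfold Rpower. assert (Hl : ln x <= 0) by (rewrite <- ln_1; apply ln_le; lra).
  destruct (Req_dec b 0) as [-> | Hb0]; [apply Rle_refl |].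
  destruct (Req_dec (ln x) 0) as [-> | Hl0]; [rewrite !Rmult_0_r; apply Rle_refl |].
  left; apply exp_increasing; nra.
Qed.

Lemma is_derive_Rpower (x b : R) :
  0 < x -> is_derive (fun r => Rpower r b) x (b * Rpower x (b - 1)).
Proof. intros Hx. apply is_derive_Reals, derivable_pt_lim_power, Hx. Qed.

Lemma locally_pos (x : R) : 0 < x -> locally x (fun y => 0 < y).
Proof. intros Hx. apply (open_gt 0 x Hx). Qed.

Lemma is_derive_rpow (x b : R) :
  0 < x -> is_derive (fun r => rpow r b) x (b * Rpower x (b - 1)).
Proof.
  intros Hx. apply is_derive_ext_loc with (fun r => Rpower r b).
  - apply filter_imp with (2 := locally_pos x Hx).
    intros y Hy; symmetry; apply rpow_Rpower, Hy.
  - apply is_derive_Rpower, Hx.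
Qed.

Lemma Rpower_inv_exponent (x b : R) : 0 < x -> b <> 0 -> Rpower (Rpower x (1 / b)) b = x.
Proof.
  intros Hx Hb. rewrite Rpower_mult. replace (1 / b * b) with 1 by (field; auto).
  apply Rpower_1, Hx.
Qed.

Lemma Rpower_lt_base (x y b : R) : 0 < x < y -> 0 < b -> Rpower x b < Rpower y b.
Proof.
  intros Hx Hb. apply exp_increasing.
  apply Rmult_lt_compat_l; [auto | apply ln_increasing; lra].
Qed.

Lemma rpow_small (b eps : R) : 0 < b -> 0 < eps ->
  exists d, 0 < d /\ forall x, Rabs x < d -> rpow x b < eps.
Proof.
  intros Hb He. exists (Rpower eps (1 / b)). split; [apply Rpower_gt0 |].
  intros x Hx. destruct (Rle_dec x 0) as [H | H].
  - rewrite rpow_nonpos; auto.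
  - rewrite rpow_Rpower by lra. rewrite <- (Rpower_inv_exponent eps b) by lra.
    rewrite Rabs_pos_eq in Hx by lra. apply Rpower_lt_base; lra.
Qed.

(** The difference quotient at step [h] is [rpow h (b - 1)], which is small for [h > 0] and zero for
    [h < 0]. The truncation on negative arguments is what makes this a two-sided derivative, as
    needed for the limit profile at the origin. *)
Lemma is_derive_rpow_0 (b : R) : 1 < b -> is_derive (fun r => rpow r b) 0 0.
Proof.
  intros Hb. apply is_derive_Reals. intros eps He.
  destruct (rpow_small (b - 1) eps) as [d [Hd Hs]]; [lra | auto |].
  exists (mkposreal d Hd). intros h Hh Hhd. simpl in Hhd.
  rewrite Rplus_0_l, (rpow_nonpos 0) by lra.
  replace b with (b - 1 + 1) by ring. rewrite rpow_S.
  replace ((rpow h (b - 1) * h - 0) / h - 0) with (rpow h (b - 1)) by (field; auto).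
  rewrite Rabs_pos_eq by apply rpow_ge0. apply Hs, Hhd.
Qed.

Lemma continuous_rpow (x b : R) : 0 < b -> continuous (fun r => rpow r b) x.
Proof.
  intros Hb. destruct (Rtotal_order x 0) as [Hx | [-> | Hx]].
  - apply continuous_ext_loc with (fun _ => 0); [| apply continuous_const].
    apply filter_imp with (2 := open_lt 0 x Hx).
    intros y Hy; symmetry; apply rpow_nonpos; lra.
  - apply continuity_pt_filterlim. intros eps He.
    destruct (rpow_small b eps Hb He) as [d [Hd Hs]].
    exists d. split; [auto |]. intros x [_ Hx].
    simpl in *. unfold Rdist in *. rewrite Rminus_0_r in Hx.
    rewrite (rpow_nonpos 0), Rminus_0_r by lra.
    rewrite Rabs_pos_eq by apply rpow_ge0. apply Hs, Hx.
  - apply (ex_derive_continuous (fun r => rpow r b)).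
    eexists; apply is_derive_rpow, Hx.
Qed.

(** Bernoulli's inequality [1 + q (y - 1) <= y^q] for [y = exp l]. It follows from [1 + x <= exp x]
    at [x = (q - 1) l] and at [x = - l]. *)
Lemma exp_bernoulli (q l : R) : 1 < q -> q * (exp l - 1) + 1 <= exp (q * l).
Proof.
  intros Hq. replace (q * l) with (l + (q - 1) * l) by ring. rewrite exp_plus.
  assert (H1 := exp_ineq1_le ((q - 1) * l)).
  assert (H2 := exp_ineq1_le (- l)).
  assert (H3 : exp l * exp (- l) = 1) by (rewrite <- exp_plus, Rplus_opp_r; apply exp_0).
  assert (H4 := exp_pos l).
  apply (Rmult_le_compat_l (exp l)) in H1, H2; [| lra ..].
  rewrite H3 in H2.
  assert (H5 : 0 <= (q - 1) * (exp l * l - (exp l - 1))) by (apply Rmult_le_pos; lra).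
  nra.
Qed.

(** The graph of [|.|^q] lies above its tangent at [a]. For [a > 0] this is Bernoulli's inequality
    for the ratio [|a + b| / a]; the cases [a = 0] and [a + b = 0], where no logarithm is available,
    are separate. *)
Lemma rpow_convex (a b q : R) : 0 <= a -> 1 < q ->
  rpow a q + q * rpow a (q - 1) * b <= rpow (Rabs (a + b)) q.
Proof.
  intros Ha Hq. destruct Ha as [Ha | <-].
  2:{ rewrite !(rpow_nonpos 0) by lra. assert (H := rpow_ge0 (Rabs (0 + b)) q). lra. }
  assert (E : rpow a q = Rpower a (q - 1) * a).
  { rewrite <- rpow_Rpower, <- rpow_S by auto. f_equal; ring. }
  assert (Hp := Rpower_gt0 a (q - 1)).
  rewrite E, (rpow_Rpower a (q - 1)) by auto.
  assert (Hab := Rle_abs (a + b)).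
  destruct (Req_dec (a + b) 0) as [H0 | H0].
  - assert (H := rpow_ge0 (Rabs (a + b)) q). replace b with (- a) by lra.
    replace (a + - a) with (a + b) by lra.
    assert (0 <= Rpower a (q - 1) * a * (q - 1)) by (repeat apply Rmult_le_pos; lra). lra.
  - apply Rabs_pos_lt in H0. set (y := Rabs (a + b)) in *.
    rewrite rpow_Rpower by auto.
    assert (B := exp_bernoulli q (ln (y / a)) Hq).
    assert (Hya : 0 < y / a) by (apply Rdiv_lt_0_compat; auto).
    rewrite exp_ln in B by auto.
    change (exp (q * ln (y / a))) with (Rpower (y / a) q) in B.
    assert (E2 : Rpower y q = Rpower a q * Rpower (y / a) q).
    { rewrite Rpower_mult_distr by auto. f_equal. field; lra. }
    rewrite E2, <- (rpow_Rpower a q), E by auto.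
    assert (E3 : y / a * a = y) by (field; lra).
    assert (H5 : Rpower a (q - 1) * (a * (q * (y / a - 1) + 1))
                 <= Rpower a (q - 1) * (a * Rpower (y / a) q)).
    { apply Rmult_le_compat_l; [lra |]. apply Rmult_le_compat_l; lra. }
    replace (a * (q * (y / a - 1) + 1)) with (q * (y - a) + a) in H5
      by (rewrite <- E3 at 1; ring).
    assert (H6 : Rpower a (q - 1) * (q * b) <= Rpower a (q - 1) * (q * (y - a))).
    { apply Rmult_le_compat_l; [lra |]. apply Rmult_le_compat_l; lra. }
    nra.
Qed.

(** * First variation on the Nehari set *)

Lemma RInt_eq_is_RInt (f : R -> R) (a b I : R) : RInt_eq f a b I <-> is_RInt f a b I.
Proof.
  split.
  - intros [pr <-]. rewrite <- RInt_Reals. apply (RInt_correct f), ex_RInt_Reals_1, pr.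
  - intros H. assert (pr : Riemann_integrable f a b) by (apply ex_RInt_Reals_0; eexists; exact H).
    exists pr. rewrite <- RInt_Reals. apply is_RInt_unique, H.
Qed.

Lemma pot_density_eq (alpha p : R) (v : R -> R) (r : R) :
  pot_density alpha p v r = rpow r (alpha + 1) * rpow (Rabs (v r)) (p + 1).
Proof. unfold pot_density. rewrite (rpow_S r alpha). ring. Qed.

Lemma profile_continuous (v v' : R -> R) (r : R) :
  radial_profile v v' -> 0 <= r <= 1 -> continuous v r /\ continuous v' r.
Proof.
  intros [H _] Hr. destruct (H r Hr) as [H1 H2]. split.
  - apply (ex_derive_continuous v). exists (v' r). apply is_derive_Reals, H1.
  - apply continuity_pt_filterlim, H2.
Qed.

Lemma ex_RInt_continuous_01 (f : R -> R) :
  (forall r, 0 <= r <= 1 -> continuous f r) -> ex_RInt f 0 1.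
Proof.
  intros H. apply (ex_RInt_continuous f). intros r. rewrite Rmin_left, Rmax_right by lra. apply H.
Qed.

Lemma continuous_mult_R (f g : R -> R) (x : R) :
  continuous f x -> continuous g x -> continuous (fun y => f y * g y) x.
Proof. intros Hf Hg. apply (continuous_mult f g); auto. Qed.

Lemma continuous_plus_R (f g : R -> R) (x : R) :
  continuous f x -> continuous g x -> continuous (fun y => f y + g y) x.
Proof. intros Hf Hg. apply (continuous_plus f g); auto. Qed.

Lemma ex_RInt_grad (v v' : R -> R) : radial_profile v v' -> ex_RInt (grad_density v') 0 1.
Proof.
  intros H. apply ex_RInt_continuous_01. intros r Hr.
  destruct (profile_continuous v v' r H Hr) as [_ Hc].
  unfold grad_density. simpl.
  repeat apply continuous_mult_R; auto using continuous_const, continuous_id.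
Qed.

Lemma ex_RInt_pot (alpha p : R) (v v' : R -> R) : 0 <= alpha -> 0 < p ->
  radial_profile v v' -> ex_RInt (pot_density alpha p v) 0 1.
Proof.
  intros Ha Hp H. apply ex_RInt_continuous_01. intros r Hr.
  destruct (profile_continuous v v' r H Hr) as [Hc _].
  apply continuous_ext with (fun r => rpow r (alpha + 1) * rpow (Rabs (v r)) (p + 1)).
  { intros x; symmetry; apply pot_density_eq. }
  apply continuous_mult_R.
  - apply continuous_rpow; lra.
  - apply (continuous_comp (fun r => Rabs (v r)) (fun x => rpow x (p + 1))).
    + apply (continuous_comp v Rabs); [auto | apply continuous_Rabs].
    + apply continuous_rpow; lra.
Qed.

Lemma profile_scal (t : R) (w w' : R -> R) : radial_profile w w' ->
  radial_profile (fun r => t * w r) (fun r => t * w' r).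
Proof.
  intros [H H1]. split; [| rewrite H1; ring].
  intros r Hr. destruct (H r Hr) as [Hd Hc]. split.
  - apply (derivable_pt_lim_scal w t r (w' r)), Hd.
  - apply (continuity_pt_scal w' t r), Hc.
Qed.

Lemma profile_perturb (s : R) (v v' f f' : R -> R) : radial_profile v v' -> radial_profile f f' ->
  radial_profile (fun r => v r + s * f r) (fun r => v' r + s * f' r).
Proof.
  intros [H H1] Hf. destruct (profile_scal s f f' Hf) as [K K1].
  split; [| rewrite H1; lra].
  intros r Hr. destruct (H r Hr) as [Hd Hc]. destruct (K r Hr) as [Kd Kc]. split.
  - apply (derivable_pt_lim_plus v (fun r => s * f r)); auto.
  - apply (continuity_pt_plus v' (fun r => s * f' r)); auto.
Qed.

(* Scaling [w] onto the Nehari set turns minimality of the energy into minimality of the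
   scale-invariant quotient [Gw ^ (p + 1) / Pw ^ 2]. *)
Lemma nehari_quotient_min (alpha p : R) (v v' w w' : R -> R) (G Gw Pw : R) :
  0 <= alpha -> 1 < p ->
  (forall w w', radial_profile w w' -> in_radial_nehari alpha p w w' ->
    forall Ev Ew, radial_energy alpha p v v' Ev -> radial_energy alpha p w w' Ew -> Ev <= Ew) ->
  is_RInt (grad_density v') 0 1 G -> is_RInt (pot_density alpha p v) 0 1 G -> 0 < G ->
  radial_profile w w' ->
  is_RInt (grad_density w') 0 1 Gw -> is_RInt (pot_density alpha p w) 0 1 Pw ->
  0 < Gw -> 0 < Pw ->
  (p - 1) * ln G <= (p + 1) * ln Gw - 2 * ln Pw.
Proof.
  intros Ha Hp Hmin HG HP HG0 Hw HGw HPw HGw0 HPw0.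
  (* This [t] solves [t^2 Gw = t^(p+1) Pw], which puts [t w] on the Nehari set. *)
  set (t := Rpower (Gw / Pw) (1 / (p - 1))).
  assert (Ht : 0 < t) by apply Rpower_gt0.
  assert (Hq : 0 < Gw / Pw) by (apply Rdiv_lt_0_compat; auto).
  assert (Htp : Rpower t (p - 1) = Gw / Pw) by (apply Rpower_inv_exponent; lra).
  assert (HtG : is_RInt (grad_density (fun r => t * w' r)) 0 1 (t ^ 2 * Gw)).
  { apply is_RInt_ext with (fun r => t ^ 2 * grad_density w' r).
    - intros x _. unfold grad_density. simpl. ring.
    - apply (is_RInt_scal (grad_density w') 0 1 (t ^ 2) Gw), HGw. }
  assert (HtP : is_RInt (pot_density alpha p (fun r => t * w r)) 0 1 (t ^ 2 * Gw)).
  { replace (t ^ 2 * Gw) with (Rpower t (p + 1) * Pw).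
    - apply is_RInt_ext with (fun r => Rpower t (p + 1) * pot_density alpha p w r).
      + intros x _. unfold pot_density. simpl.
        rewrite Rabs_mult, (Rabs_pos_eq t), rpow_mult by lra. ring.
      + apply (is_RInt_scal (pot_density alpha p w) 0 1 _ Pw), HPw.
    - replace (p + 1) with (p - 1 + 1 + 1) by ring.
      rewrite !Rpower_S, Htp by auto. field; lra. }
  assert (Hle : G <= t ^ 2 * Gw).
  (* On the Nehari set the energy is this positive constant times the Dirichlet integral, so
     comparing energies amounts to comparing [G] with [t^2 Gw]. *)
  { assert (Hc : 0 < 2 * PI * (1 / 2 - 1 / (p + 1))).
    { apply Rmult_lt_0_compat; [assert (H := PI_RGT_0); lra |].
      replace (1 / 2 - 1 / (p + 1)) with ((p - 1) / (2 * (p + 1))) by (field; lra).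
      apply Rdiv_lt_0_compat; lra. }
    apply Rmult_le_reg_l with (1 := Hc).
    apply (Hmin (fun r => t * w r) (fun r => t * w' r)).
    - apply profile_scal, Hw.
    - split.
      + apply NNPP. intros Hno. apply (Rlt_irrefl 0).
        replace 0 with Pw at 2; [exact HPw0 |].
        rewrite <- (is_RInt_unique _ _ _ _ HPw).
        rewrite (RInt_ext _ (fun _ => 0)).
        * rewrite RInt_const. unfold scal; simpl; unfold mult; simpl. ring.
        * intros x Hx. rewrite Rmin_left, Rmax_right in Hx by lra.
          rewrite pot_density_eq. replace (w x) with 0.
          { rewrite Rabs_R0, (rpow_nonpos 0) by lra. apply Rmult_0_r. }
          apply NNPP. intros Hx0. apply Hno. exists x. split; [lra |].
          apply Rmult_integral_contrapositive_currified; lra.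
      + exists (t ^ 2 * Gw). split; apply RInt_eq_is_RInt; auto.
    - exists G, G. rewrite !RInt_eq_is_RInt. repeat split; auto. field. lra.
    - exists (t ^ 2 * Gw), (t ^ 2 * Gw). rewrite !RInt_eq_is_RInt. repeat split; auto.
      field. lra. }
  apply ln_le in Hle; [| auto].
  rewrite ln_mult in Hle by (auto; apply pow_lt, Ht).
  simpl in Hle. rewrite Rmult_1_r, ln_mult in Hle by auto.
  assert (Hlt : ln t = (ln Gw - ln Pw) / (p - 1)).
  { unfold t, Rpower. rewrite ln_exp, ln_div by auto. field; lra. }
  rewrite Hlt in Hle.
  apply Rmult_le_compat_l with (r := p - 1) in Hle; [| lra].
  replace ((p - 1) * ((ln Gw - ln Pw) / (p - 1) + (ln Gw - ln Pw) / (p - 1) + ln Gw))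
    with ((p + 1) * ln Gw - 2 * ln Pw) in Hle by (field; lra).
  exact Hle.
Qed.

(* Convexity of [|.|^(p+1)] bounds [P (v + s f)] below by its linearization, which replaces
   differentiation under the integral. *)
Lemma least_energy_first_variation (alpha p : R) (v v' f f' : R -> R) (G a b : R) :
  0 <= alpha -> 1 < p ->
  (forall w w', radial_profile w w' -> in_radial_nehari alpha p w w' ->
    forall Ev Ew, radial_energy alpha p v v' Ev -> radial_energy alpha p w w' Ew -> Ev <= Ew) ->
  radial_profile v v' -> (forall r, 0 <= r <= 1 -> 0 <= v r) ->
  is_RInt (grad_density v') 0 1 G -> is_RInt (pot_density alpha p v) 0 1 G -> 0 < G ->
  radial_profile f f' ->
  is_RInt (fun r => v' r * f' r * r) 0 1 a ->
  is_RInt (fun r => rpow r (alpha + 1) * rpow (v r) p * f r) 0 1 b ->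
  a = b.
Proof.
  intros Ha Hp Hmin Hv Hv0 HG HP HG0 Hf Haa Hbb.
  destruct (ex_RInt_grad f f' Hf) as [c Hc].
  assert (Hc0 : 0 <= c).
  { apply (is_RInt_ge_0 (grad_density f') 0 1); [lra | exact Hc |].
    intros x Hx. unfold grad_density. apply Rmult_le_pos; [apply pow2_ge_0 | lra]. }
  (* The second logarithm contains the linear minorant of [P (v + s f)], so [h s] lies above the
     logarithm of the quotient of [v + s f], with equality at [s = 0]. Hence [h] is minimal at 0,
     where its derivative is [2 (p + 1) / G * (a - b)]. *)
  set (h := fun s => (p + 1) * ln (G + 2 * s * a + s ^ 2 * c) - 2 * ln (G + (p + 1) * s * b)).
  (* For [|s| D < G] the arguments of both logarithms are positive; the summand 1 keeps [D] positive
     when [a] and [b] vanish. *)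
  set (D := 2 * Rabs a + (p + 1) * Rabs b + 1).
  assert (HD : 0 < D).
  { unfold D. assert (H1 := Rabs_pos a). assert (H2 := Rabs_pos b). nra. }
  set (d := G / D). assert (Hd : 0 < d) by (apply Rdiv_lt_0_compat; auto).
  assert (Hh : forall s, - d < s < d -> h 0 <= h s).
  { intros s Hs.
    assert (HsD : Rabs s * D < G).
    { replace G with (d * D) by (unfold d; field; lra).
      apply Rmult_lt_compat_r; auto. apply Rabs_def1; lra. }
    assert (Hsa : - (Rabs s * Rabs a) <= s * a)
      by (rewrite <- Rabs_mult; assert (H := Rle_abs (- (s * a))); rewrite Rabs_Ropp in H; lra).
    assert (Hsb : - (Rabs s * Rabs b) <= s * b)
      by (rewrite <- Rabs_mult; assert (H := Rle_abs (- (s * b))); rewrite Rabs_Ropp in H; lra).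
    assert (Hss := Rabs_pos s). assert (Ha0 := Rabs_pos a). assert (Hb0 := Rabs_pos b).
    assert (Q1 : 0 <= Rabs s * Rabs a) by (apply Rmult_le_pos; auto).
    assert (Q2 : 0 <= (p + 1) * (Rabs s * Rabs b))
      by (repeat apply Rmult_le_pos; auto; lra).
    assert (Q3 : (p + 1) * - (Rabs s * Rabs b) <= (p + 1) * (s * b))
      by (apply Rmult_le_compat_l; lra).
    assert (Q4 : 0 <= s ^ 2 * c) by (apply Rmult_le_pos; [apply pow2_ge_0 | auto]).
    assert (EQ : Rabs s * D = 2 * (Rabs s * Rabs a) + (p + 1) * (Rabs s * Rabs b) + Rabs s)
      by (unfold D; ring).
    assert (P1 : 0 < G + 2 * s * a + s ^ 2 * c) by lra.
    assert (P2 : 0 < G + (p + 1) * s * b) by lra.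
    set (w := fun r => v r + s * f r). set (w' := fun r => v' r + s * f' r).
    assert (Hw : radial_profile w w') by (apply profile_perturb; auto).
    assert (HGw : is_RInt (grad_density w') 0 1 (G + 2 * s * a + s ^ 2 * c)).
    { apply is_RInt_ext with
        (fun r => grad_density v' r + 2 * s * (v' r * f' r * r) + s ^ 2 * grad_density f' r).
      - intros x _. unfold grad_density, w'. simpl. ring.
      - apply (is_RInt_plus (V := R_NormedModule)); [apply (is_RInt_plus (V := R_NormedModule)) |].
        + exact HG.
        + apply (is_RInt_scal (V := R_NormedModule)), Haa.
        + apply (is_RInt_scal (V := R_NormedModule)), Hc. }
    destruct (ex_RInt_pot alpha p w w') as [Pw HPw]; [lra | lra | auto |].
    assert (HPle : G + (p + 1) * s * b <= Pw).
    { apply (is_RInt_le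
        (fun r => pot_density alpha p v r
           + (p + 1) * s * (rpow r (alpha + 1) * rpow (v r) p * f r))
        (pot_density alpha p w) 0 1); [lra | | exact HPw |].
      - apply (is_RInt_plus (V := R_NormedModule)); [exact HP |].
        apply (is_RInt_scal (V := R_NormedModule)), Hbb.
      - intros x Hx. rewrite !pot_density_eq.
        assert (Hvx : 0 <= v x) by (apply Hv0; lra).
        assert (C := rpow_convex (v x) (s * f x) (p + 1) Hvx ltac:(lra)).
        rewrite (Rabs_pos_eq (v x)) by auto. fold (w x) in C.
        replace (p + 1 - 1) with p in C by ring.
        apply Rmult_le_compat_l with (r := rpow x (alpha + 1)) in C; [| apply rpow_ge0].
        lra. }
    assert (M := nehari_quotient_min alpha p v v' w w' G _ _ Ha Hp Hmin HG HP HG0 Hw HGw HPw P1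
                  ltac:(lra)).
    assert (L : ln (G + (p + 1) * s * b) <= ln Pw) by (apply ln_le; lra).
    unfold h. rewrite !Rmult_0_r, !Rmult_0_l, pow_i, Rmult_0_l, !Rplus_0_r by lia.
    lra. }
  assert (Hder : derivable_pt_lim h 0 ((p + 1) * (2 * a / G) - 2 * ((p + 1) * b / G))).
  { apply is_derive_Reals. unfold h. auto_derive.
    - repeat split; lra.
    - field. lra. }
  assert (E := deriv_minimum h (- d) d 0 (exist _ _ Hder) ltac:(lra) ltac:(lra)
                              (fun s Hl Hr => Hh s (conj Hl Hr))).
  rewrite (derive_pt_eq_0 _ _ _ _ Hder) in E.
  replace ((p + 1) * (2 * a / G) - 2 * ((p + 1) * b / G))
    with (2 * (p + 1) / G * (a - b)) in E by (field; lra).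
  apply Rmult_integral in E. destruct E as [E | E]; [| lra].
  exfalso. assert (0 < 2 * (p + 1) / G) by (apply Rdiv_lt_0_compat; lra). lra.
Qed.

(** * The du Bois-Reymond argument and the radial Euler-Lagrange equation *)

Lemma ex_RInt_continuous_everywhere (g : R -> R) (a b : R) :
  (forall x, continuous g x) -> ex_RInt g a b.
Proof. intros H. apply (ex_RInt_continuous g). intros z _. apply H. Qed.

Lemma is_derive_primitive (g : R -> R) (a x : R) :
  (forall x, continuous g x) -> is_derive (fun y => RInt g a y) x (g x).
Proof.
  intros H. apply (is_derive_RInt g (fun y => RInt g a y) a x); [| apply H].
  apply filter_forall. intros y. apply (RInt_correct g), ex_RInt_continuous_everywhere, H.
Qed.

(* Profiles are controlled on [[0, 1]] only; composing with [clamp] makes them continuous on the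
   whole line. *)
Definition clamp (r : R) : R := (Rabs r - Rabs (r - 1) + 1) / 2.

Lemma clamp_id (r : R) : 0 <= r <= 1 -> clamp r = r.
Proof.
  intros Hr. unfold clamp. rewrite Rabs_pos_eq, Rabs_left1 by lra. field.
Qed.

Lemma clamp_range (r : R) : 0 <= clamp r <= 1.
Proof. unfold clamp, Rabs. destruct (Rcase_abs r), (Rcase_abs (r - 1)); lra. Qed.

Lemma continuous_clamp (r : R) : continuous clamp r.
Proof.
  unfold clamp. apply continuous_mult_R; [| apply continuous_const].
  apply continuous_plus_R; [| apply continuous_const].
  apply (continuous_minus Rabs (fun r => Rabs (r - 1))); [apply continuous_Rabs |].
  apply (continuous_comp (fun r => r - 1) Rabs); [| apply continuous_Rabs].
  apply (continuous_minus (fun r : R => r) (fun _ => 1)).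
  - apply continuous_id.
  - apply continuous_const.
Qed.

Lemma continuous_comp_clamp (g : R -> R) (r : R) :
  (forall x, 0 <= x <= 1 -> continuous g x) -> continuous (fun x => g (clamp x)) r.
Proof.
  intros H. apply (continuous_comp clamp g); [apply continuous_clamp |].
  apply H, clamp_range.
Qed.

Lemma RInt_pos_continuous_zero (g : R -> R) : (forall x, continuous g x) ->
  (forall x, 0 <= g x) -> RInt g 0 1 = 0 -> forall r, 0 < r < 1 -> g r = 0.
Proof.
  intros Hc Hp HI r Hr. destruct (Hp r) as [Hgr | Hgr]; [exfalso | auto].
  assert (Hloc : locally r (fun y => 0 < g y)).
  { apply (Hc r (fun z => 0 < z)). apply locally_pos, Hgr. }
  destruct Hloc as [d Hd].
  set (e := Rmin (d / 2) (Rmin (r / 2) ((1 - r) / 2))).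
  assert (He : 0 < e).
  { destruct d as [d Hd0]. unfold e; simpl. repeat apply Rmin_glb_lt; lra. }
  assert (He1 : e <= d / 2) by apply Rmin_l.
  assert (He2 : e <= r / 2) by (eapply Rle_trans; [apply Rmin_r | apply Rmin_l]).
  assert (He3 : e <= (1 - r) / 2) by (eapply Rle_trans; [apply Rmin_r | apply Rmin_r]).
  assert (E1 : RInt g 0 r + RInt g r 1 = RInt g 0 1)
    by (apply (RInt_Chasles g); apply ex_RInt_continuous_everywhere; auto).
  assert (E2 : RInt g r (r + e) + RInt g (r + e) 1 = RInt g r 1)
    by (apply (RInt_Chasles g); apply ex_RInt_continuous_everywhere; auto).
  assert (N1 : 0 <= RInt g 0 r)
    by (apply RInt_ge_0; [lra | apply ex_RInt_continuous_everywhere; auto | auto]).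
  assert (N2 : 0 <= RInt g (r + e) 1)
    by (apply RInt_ge_0; [lra | apply ex_RInt_continuous_everywhere; auto | auto]).
  assert (N3 : 0 < RInt g r (r + e)).
  { apply RInt_gt_0; [lra | | auto]. intros x Hx. apply Hd.
    unfold ball; simpl; unfold AbsRing_ball, abs, minus, plus, opp; simpl.
    apply Rabs_def1; destruct d as [d Hd0]; simpl in *; lra. }
  lra.
Qed.

(** For [0 <= r <= 1] this is, up to the factor [2 pi], the integral of the right-hand side of the
    equation over the disc of radius [r]. *)
Definition absorbed_mass (alpha p : R) (v : R -> R) (r : R) : R :=
  RInt (fun s => rpow s (alpha + 1) * rpow (v (clamp s)) p) 0 r.

(* du Bois-Reymond: the test function with derivative [r v' + F], where [F] is the primitive of
   the nonlinearity, gives [int (r v' + F)^2 = 0]. *)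
Lemma least_energy_integrated_equation (alpha p : R) (v v' : R -> R) :
  0 <= alpha -> 1 < p -> radial_profile v v' -> in_radial_nehari alpha p v v' ->
  (forall w w', radial_profile w w' -> in_radial_nehari alpha p w w' ->
    forall Ev Ew, radial_energy alpha p v v' Ev -> radial_energy alpha p w w' Ew -> Ev <= Ew) ->
  (forall r, 0 <= r < 1 -> v r > 0) ->
  forall r, 0 < r < 1 -> v' r * r = - absorbed_mass alpha p v r.
Proof.
  intros Ha Hp Hv [_ [G [HG HP]]] Hmin Hpos.
  apply RInt_eq_is_RInt in HG, HP.
  assert (Hv0 : forall r, 0 <= r <= 1 -> 0 <= v r).
  { intros r Hr. destruct (Req_dec r 1) as [-> | Hr1].
    - destruct Hv as [_ ->]. lra.
    - left; apply Hpos; lra. }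
  assert (Hvc := fun r => profile_continuous v v' r Hv).
  assert (HG0 : 0 < G).
  { rewrite <- (is_RInt_unique _ _ _ _ HP). apply RInt_gt_0; [lra | |].
    - intros x Hx. assert (Hvx : v x > 0) by (apply Hpos; lra).
      rewrite pot_density_eq, !rpow_Rpower; [| rewrite Rabs_pos_eq; lra | lra].
      apply Rmult_lt_0_compat; apply Rpower_gt0.
    - intros x Hx. apply continuous_ext with
        (fun r => rpow r (alpha + 1) * rpow (Rabs (v r)) (p + 1)).
      { intros y; symmetry; apply pot_density_eq. }
      apply continuous_mult_R; [apply continuous_rpow; lra |].
      apply (continuous_comp (fun r => Rabs (v r)) (fun y => rpow y (p + 1)));
        [| apply continuous_rpow; lra].
      apply (continuous_comp v Rabs); [apply Hvc; lra | apply continuous_Rabs]. }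
  set (k := fun s => rpow s (alpha + 1) * rpow (v (clamp s)) p).
  assert (Hk : forall x, continuous k x).
  { intros x. apply continuous_mult_R; [apply continuous_rpow; lra |].
    apply (continuous_comp (fun r => v (clamp r)) (fun y => rpow y p));
      [| apply continuous_rpow; lra].
    apply continuous_comp_clamp. intros y Hy; apply Hvc, Hy. }
  set (F := fun r => RInt k 0 r).
  assert (HF : forall x, is_derive F x (k x)) by (intros x; apply is_derive_primitive, Hk).
  set (psi := fun r => v' (clamp r) * r + F r).
  assert (Hpsi : forall x, continuous psi x).
  { intros x. apply continuous_plus_R.
    - apply continuous_mult_R; [| apply continuous_id].
      apply continuous_comp_clamp. intros y Hy; apply Hvc, Hy.
    - apply (ex_derive_continuous F). exists (k x). apply HF. }
  (* Integrating from 1 gives [phi 1 = 0], so [phi] is an admissible test function. *)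
  set (phi := fun r => RInt psi 1 r).
  assert (Hphi : forall x, is_derive phi x (psi x)) by (intros x; apply is_derive_primitive, Hpsi).
  assert (Hphi1 : phi 1 = 0) by apply (RInt_point 1 psi).
  assert (Hpr : radial_profile phi psi).
  { split; [| exact Hphi1]. intros r _. split.
    - apply is_derive_Reals, Hphi.
    - apply continuity_pt_filterlim, Hpsi. }
  assert (Hcv' : forall x, continuous (fun r => v' (clamp r)) x)
    by (intros x; apply continuous_comp_clamp; intros y Hy; apply Hvc, Hy).
  assert (Hcphi : forall x, continuous phi x)
    by (intros x; apply (ex_derive_continuous phi); exists (psi x); apply Hphi).
  assert (HcF : forall x, continuous F x)
    by (intros x; apply (ex_derive_continuous F); exists (k x); apply HF).
  set (a := RInt (fun r => v' (clamp r) * psi r * r) 0 1).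
  assert (Hia : is_RInt (fun r => v' (clamp r) * psi r * r) 0 1 a).
  { apply (RInt_correct (fun r => v' (clamp r) * psi r * r)), ex_RInt_continuous_everywhere.
    intros x. repeat apply continuous_mult_R; auto. apply continuous_id. }
  set (b := RInt (fun r => k r * phi r) 0 1).
  assert (Hib : is_RInt (fun r => k r * phi r) 0 1 b).
  { apply (RInt_correct (fun r => k r * phi r)), ex_RInt_continuous_everywhere.
    intros x. apply continuous_mult_R; auto. }
  assert (Hab : a = b).
  { apply (least_energy_first_variation alpha p v v' phi psi G a b); auto.
    - apply is_RInt_ext with (2 := Hia). intros x Hx.
      rewrite Rmin_left, Rmax_right in Hx by lra. rewrite clamp_id by lra. reflexivity.
    - apply is_RInt_ext with (2 := Hib). intros x Hx.
      rewrite Rmin_left, Rmax_right in Hx by lra. unfold k. rewrite clamp_id by lra. reflexivity. }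
  (* Integration by parts: the integrand is [(F phi)'], and the boundary terms vanish because
     [phi 1 = 0] and [F 0 = 0]. Added to [a - b = 0], it turns [r v' psi - k phi] into
     [(r v' + F) psi], which is [psi^2]. *)
  assert (Hparts : is_RInt (fun r => k r * phi r + F r * psi r) 0 1 0).
  { replace 0 with (minus (F 1 * phi 1) (F 0 * phi 0)) at 2.
    - apply (is_RInt_derive (fun r => F r * phi r)).
      + intros x _. apply (is_derive_mult F phi x (k x) (psi x)); auto. intros; apply Rmult_comm.
      + intros x _. apply continuous_plus_R; apply continuous_mult_R; auto.
    - rewrite Hphi1. unfold F at 2. rewrite RInt_point.
      unfold minus, plus, opp, zero; simpl. ring. }
  assert (Hsq : is_RInt (fun r => psi r * psi r) 0 1 0).
  { replace 0 with (plus (minus a b) 0) at 2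
      by (rewrite Hab; unfold minus, plus, opp; simpl; ring).
    apply is_RInt_ext with (fun r => plus (minus (v' (clamp r) * psi r * r) (k r * phi r))
                                        (k r * phi r + F r * psi r)).
    - intros x _. unfold minus, plus, opp, psi; simpl. ring.
    - apply (is_RInt_plus (V := R_NormedModule)); [| exact Hparts].
      apply (is_RInt_minus (V := R_NormedModule)); auto. }
  intros r Hr.
  assert (Hz : psi r * psi r = 0).
  { apply (RInt_pos_continuous_zero (fun r => psi r * psi r)); auto.
    - intros x; apply continuous_mult_R; auto.
    - intros x; apply Rle_0_sqr.
    - apply is_RInt_unique, Hsq. }
  apply Rsqr_0_uniq in Hz. unfold psi in Hz. rewrite clamp_id in Hz by lra.
  change (absorbed_mass alpha p v r) with (F r). lra.
Qed.

(** The integrated equation reads [v' = - F / r] with [F] differentiable, so [v'] gains the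
    derivative that a C^1 profile does not provide. The value at 0 comes from continuity of [v']
    there. *)
Lemma least_energy_euler_lagrange (alpha p : R) (v : R -> R) : 0 <= alpha -> 1 < p ->
  pos_least_energy_radial alpha p v ->
  exists v', radial_profile v v' /\ v' 0 = 0 /\
    forall r, 0 < r < 1 ->
      is_derive v' r (- (v' r / r) - Rpower r alpha * Rpower (v r) p).
Proof.
  intros Ha Hp [[v' [Hv [Hn Hmin]]] Hpos]. exists v'. split; [exact Hv |].
  assert (HE := least_energy_integrated_equation alpha p v v' Ha Hp Hv Hn Hmin Hpos).
  set (k := fun s => rpow s (alpha + 1) * rpow (v (clamp s)) p).
  assert (Hk : forall x, continuous k x).
  { intros x. apply continuous_mult_R; [apply continuous_rpow; lra |].
    apply (continuous_comp (fun r => v (clamp r)) (fun y => rpow y p));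
      [| apply continuous_rpow; lra].
    apply continuous_comp_clamp. intros y Hy; apply (profile_continuous v v' y Hv Hy). }
  set (F := absorbed_mass alpha p v).
  assert (HF : forall x, is_derive F x (k x)) by (intros x; apply is_derive_primitive, Hk).
  assert (HF0 : F 0 = 0) by apply (RInt_point 0 k).
  assert (Hv' : forall r, 0 < r < 1 -> v' r = - F r / r).
  { intros r Hr. rewrite <- HE by auto. field. lra. }
  split.
  - (* [F r / r -> F' 0 = k 0 = 0] *)
    assert (Hk0 : k 0 = 0) by (unfold k; rewrite (rpow_nonpos 0) by lra; ring).
    assert (HD := HF 0). rewrite Hk0 in HD. apply is_derive_Reals in HD.
    destruct (Hv) as [Hv1 _]. destruct (Hv1 0 ltac:(lra)) as [_ Hc].
    apply NNPP. intros Hne.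
    assert (He : 0 < Rabs (v' 0) / 2) by (apply Rabs_pos_lt in Hne; lra).
    destruct (HD _ He) as [d Hd]. destruct (Hc _ He) as [d' [Hd' Hc']].
    set (h := Rmin (1 / 2) (Rmin (d / 2) (d' / 2))).
    assert (Hd0 := cond_pos d).
    assert (Hh : 0 < h) by (unfold h; repeat apply Rmin_glb_lt; lra).
    assert (Hh1 : h <= 1 / 2) by apply Rmin_l.
    assert (Hh2 : h <= d / 2) by (eapply Rle_trans; [apply Rmin_r | apply Rmin_l]).
    assert (Hh3 : h <= d' / 2) by (eapply Rle_trans; [apply Rmin_r | apply Rmin_r]).
    assert (A1 : Rabs (F h / h) < Rabs (v' 0) / 2).
    { replace (F h / h) with ((F (0 + h) - F 0) / h - 0)
        by (rewrite HF0, Rplus_0_l; field; lra).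
      apply Hd; [lra |]. rewrite Rabs_pos_eq; lra. }
    assert (A2 : Rabs (v' h - v' 0) < Rabs (v' 0) / 2).
    { apply (Hc' h). split.
      - split; [exact I | lra].
      - simpl. unfold Rdist. rewrite Rabs_pos_eq; lra. }
    rewrite (Hv' h) in A2 by lra.
    assert (A3 := Rabs_triang (F h / h) (- F h / h - v' 0)).
    replace (F h / h + (- F h / h - v' 0)) with (- v' 0) in A3 by (field; lra).
    rewrite Rabs_Ropp in A3. lra.
  - intros r Hr.
    apply is_derive_ext_loc with (fun r => - F r / r).
    + assert (L : locally r (fun y => 0 < y < 1))
        by (apply (open_and _ _ (open_gt 0) (open_lt 1)); exact Hr).
      apply filter_imp with (2 := L). intros y Hy; symmetry; apply Hv', Hy.
    + assert (HFr := HF r).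
      assert (Ek : k r = r * Rpower r alpha * Rpower (v r) p).
      { assert (Hvr : 0 < v r) by (apply Hpos; lra).
        unfold k. rewrite clamp_id, rpow_S, !rpow_Rpower by lra. ring. }
      rewrite Hv' by auto. auto_derive.
      * repeat split; [eexists; exact HFr | lra].
      * rewrite (is_derive_unique (fun x : R => F x) r _ HFr : Derive (fun x : R => F x) r = _), Ek.
        field. lra.
Qed.

(** * The rescaled equation *)

Lemma nonincreasing_of_derive (f df : R -> R) (a b : R) : a <= b ->
  (forall x, a < x < b -> is_derive f x (df x)) ->
  (forall x, a <= x <= b -> continuous f x) ->
  (forall x, a < x < b -> df x <= 0) -> f b <= f a.
Proof.
  intros Hab Hd Hc Hneg.
  (* [MVT_gen] may return an endpoint, where nothing is known about [df]; extending by 0 keeps the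
     sign there. *)
  set (df0 := fun x => if Rlt_dec a x then if Rlt_dec x b then df x else 0 else 0).
  destruct (MVT_gen f a b df0) as [c [_ E]].
  - intros x Hx. rewrite Rmin_left, Rmax_right in Hx by auto. unfold df0.
    destruct (Rlt_dec a x); [| lra]. destruct (Rlt_dec x b); [| lra]. apply Hd; auto.
  - intros x Hx. rewrite Rmin_left, Rmax_right in Hx by auto.
    apply continuity_pt_filterlim, Hc, Hx.
  - assert (df0 c <= 0).
    { unfold df0. destruct (Rlt_dec a c); [| lra]. destruct (Rlt_dec c b); [| lra]. auto. }
    nra.
Qed.

(* [z r = p (v (rho r) - v 0) / v 0] on [[0, S]] with [S = 1 / rho]; the boundary condition
   [v 1 = 0] becomes [z S = - p]. *)
Definition rescaled_solution (alpha p S : R) (z z1 : R -> R) : Prop :=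
  0 < S /\ z 0 = 0 /\ z1 0 = 0 /\ z S = - p /\
  (forall r, 0 <= r <= S -> continuous z r /\ continuous z1 r) /\
  (forall r, 0 < r < S -> - p < z r /\ is_derive z r (z1 r) /\
     is_derive z1 r (- (z1 r / r) - Rpower r alpha * Rpower (1 + z r / p) p)).

Section Rescaled.
Variables (alpha p S : R) (z z1 : R -> R).
Hypotheses (Ha : 0 <= alpha) (Hp : 1 < p) (HS : rescaled_solution alpha p S z z1).

Let S_pos : 0 < S. Proof. apply HS. Qed.
Let z_0 : z 0 = 0. Proof. apply HS. Qed.
Let z_S : z S = - p. Proof. apply HS. Qed.
Let z_cont r : 0 <= r <= S -> continuous z r. Proof. intros; apply HS; auto. Qed.
Let z1_cont r : 0 <= r <= S -> continuous z1 r. Proof. intros; apply HS; auto. Qed.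
Let z_gt r : 0 < r < S -> - p < z r. Proof. intros; apply HS; auto. Qed.
Let z_der r : 0 < r < S -> is_derive z r (z1 r). Proof. intros; apply HS; auto. Qed.
Let f r := Rpower (1 + z r / p) p.
Let z1_der r : 0 < r < S -> is_derive z1 r (- (z1 r / r) - Rpower r alpha * f r).
Proof. intros; apply HS; auto. Qed.
(** By the equation, [- flux r] is the mass of [s^(1+alpha) f s] on [[0, r]]. *)
Let flux r := r * z1 r.

Lemma flux_continuous r : 0 <= r <= S -> continuous flux r.
Proof. intros Hr. apply continuous_mult_R; [apply continuous_id | apply z1_cont, Hr]. Qed.

Lemma flux_derive r : 0 < r < S -> is_derive flux r (- (Rpower r (1 + alpha) * f r)).
Proof.
  intros Hr. unfold flux.
  assert (H := z1_der r Hr).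
  replace (1 + alpha) with (alpha + 1) by ring. rewrite Rpower_S by lra.
  replace (- (Rpower r alpha * r * f r))
    with (1 * z1 r + r * (- (z1 r / r) - Rpower r alpha * f r)) by (field; lra).
  apply (is_derive_mult (fun r : R => r) z1 r 1).
  - apply (is_derive_id r).
  - exact H.
  - intros; apply Rmult_comm.
Qed.

Lemma flux_decreasing r t : 0 <= r <= t -> t <= S -> flux t <= flux r.
Proof.
  intros Hr Ht. apply (nonincreasing_of_derive flux (fun r => - (Rpower r (1 + alpha) * f r))).
  - lra.
  - intros x Hx; apply flux_derive; lra.
  - intros x Hx; apply flux_continuous; lra.
  - intros x Hx. assert (0 < Rpower x (1 + alpha) * f x); [| lra].
    apply Rmult_lt_0_compat; apply Rpower_gt0.
Qed.

Lemma flux_0 : flux 0 = 0.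
Proof. unfold flux; ring. Qed.

Lemma flux_le0 r : 0 <= r <= S -> flux r <= 0.
Proof. intros Hr. rewrite <- flux_0. apply flux_decreasing; lra. Qed.

Lemma rescaled_derivative_flux r : 0 < r -> z1 r = flux r / r.
Proof. intros Hr. unfold flux. field; lra. Qed.

Lemma rescaled_derivative_le0 r : 0 < r <= S -> z1 r <= 0.
Proof.
  intros Hr. rewrite rescaled_derivative_flux by lra. assert (H := flux_le0 r ltac:(lra)).
  assert (0 < / r) by (apply Rinv_0_lt_compat; lra). unfold Rdiv. nra.
Qed.

Lemma rescaled_le0 r : 0 <= r <= S -> z r <= 0.
Proof.
  intros Hr. rewrite <- z_0. apply (nonincreasing_of_derive z z1); [lra | | |].
  - intros x Hx; apply z_der; lra.
  - intros x Hx; apply z_cont; lra.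
  - intros x Hx; apply rescaled_derivative_le0; lra.
Qed.

Lemma nonlinearity_base_range r : 0 < r < S -> 0 < 1 + z r / p <= 1.
Proof.
  intros Hr. assert (H1 := z_gt r Hr). assert (H2 := rescaled_le0 r ltac:(lra)).
  assert (H3 : z r / p * p = z r) by (field; lra).
  split; apply Rmult_lt_reg_r with p || apply Rmult_le_reg_r with p; lra.
Qed.

Lemma nonlinearity_range r : 0 < r < S -> 0 < f r <= 1.
Proof.
  intros Hr. split; [apply Rpower_gt0 |]. apply Rpower_le1; [apply nonlinearity_base_range, Hr | lra].
Qed.

(** Since [f <= 1], the mass on [[0, r]] is at most the integral of [s^(1+alpha)]. *)
Lemma flux_lower r : 0 <= r <= S -> - (rpow r (2 + alpha) / (2 + alpha)) <= flux r.
Proof.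
  intros Hr.
  enough (H : - flux r - rpow r (2 + alpha) / (2 + alpha)
              <= - flux 0 - rpow 0 (2 + alpha) / (2 + alpha)).
  { rewrite flux_0, (rpow_nonpos 0) in H by lra. lra. }
  apply (nonincreasing_of_derive (fun r => - flux r - rpow r (2 + alpha) / (2 + alpha))
    (fun r => Rpower r (1 + alpha) * f r - Rpower r (1 + alpha))); [lra | | |].
  - intros x Hx. assert (H1 := flux_derive x ltac:(lra)).
    assert (H2 := is_derive_rpow x (2 + alpha) ltac:(lra)).
    auto_derive.
    + repeat split; [eexists; exact H1 | eexists; exact H2].
    + rewrite (is_derive_unique (fun x : R => flux x) _ _ H1 : Derive (fun x : R => flux x) x = _).
      rewrite (is_derive_unique _ _ _ H2 : Derive (fun x : R => rpow x (2 + alpha)) x = _).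
      replace (2 + alpha - 1) with (1 + alpha) by ring. field; lra.
  - intros x Hx. apply (continuous_minus (fun r => - flux r)
      (fun r => rpow r (2 + alpha) / (2 + alpha))).
    + apply (continuous_opp flux), flux_continuous; lra.
    + apply continuous_mult_R; [apply continuous_rpow; lra | apply continuous_const].
  - intros x Hx. assert (H := nonlinearity_range x ltac:(lra)).
    assert (H0 := Rpower_gt0 x (1 + alpha)). nra.
Qed.

Lemma rescaled_lower r : 0 <= r <= S -> - (rpow r (2 + alpha) / (2 + alpha) ^ 2) <= z r.
Proof.
  intros Hr.
  enough (H : - z r - rpow r (2 + alpha) / (2 + alpha) ^ 2
              <= - z 0 - rpow 0 (2 + alpha) / (2 + alpha) ^ 2).
  { rewrite z_0, (rpow_nonpos 0) in H by lra. lra. }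
  apply (nonincreasing_of_derive (fun r => - z r - rpow r (2 + alpha) / (2 + alpha) ^ 2)
    (fun r => - z1 r - Rpower r (1 + alpha) / (2 + alpha))); [lra | | |].
  - intros x Hx. assert (H1 := z_der x ltac:(lra)).
    assert (H2 := is_derive_rpow x (2 + alpha) ltac:(lra)).
    auto_derive.
    + repeat split; [eexists; exact H1 | eexists; exact H2].
    + rewrite (is_derive_unique (fun x : R => z x) _ _ H1 : Derive (fun x : R => z x) x = _).
      rewrite (is_derive_unique _ _ _ H2 : Derive (fun x : R => rpow x (2 + alpha)) x = _).
      replace (2 + alpha - 1) with (1 + alpha) by ring. field; lra.
  - intros x Hx.
    apply (continuous_minus (fun r => - z r) (fun r => rpow r (2 + alpha) / (2 + alpha) ^ 2)).
    + apply (continuous_opp z), z_cont; lra.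
    + apply continuous_mult_R; [apply continuous_rpow; lra | apply continuous_const].
  - intros x Hx. assert (H := flux_lower x ltac:(lra)). unfold flux in H.
    replace (2 + alpha) with (1 + alpha + 1) in H at 1 by ring.
    rewrite rpow_S, rpow_Rpower in H by lra.
    apply Rmult_le_reg_l with x; [lra |]. unfold Rdiv in *. lra.
Qed.

(** [z] has to fall to [- p] at [S], and [rescaled_lower] limits how early this can happen. *)
Lemma radius_lower_bound : p * (2 + alpha) ^ 2 <= Rpower S (2 + alpha).
Proof.
  assert (H := rescaled_lower S ltac:(lra)). rewrite z_S, rpow_Rpower in H by apply S_pos.
  assert (E : Rpower S (2 + alpha) / (2 + alpha) ^ 2 * (2 + alpha) ^ 2 = Rpower S (2 + alpha))
    by (field; lra).
  assert (0 < (2 + alpha) ^ 2) by (apply pow_lt; lra). nra.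
Qed.

Lemma radius_gt1 : 1 < S.
Proof.
  apply Rnot_le_lt. intros H1. assert (H := radius_lower_bound).
  assert (Rpower S (2 + alpha) <= 1) by (apply Rpower_le1; [split; [apply S_pos |] |]; lra).
  assert (4 <= (2 + alpha) ^ 2) by nra. nra.
Qed.

(* Pohozaev: [flux^2/2 + (2+alpha) flux + p/(p+1) r^(2+alpha) (1+z/p)^(p+1)] is nonincreasing. *)
Lemma flux_ge_total_mass r : 0 <= r < S -> - (2 * (2 + alpha)) <= flux r.
Proof.
  intros Hr. destruct (Req_dec r 0) as [-> | Hr0]; [rewrite flux_0; lra |].
  set (b := 2 + alpha) in *.
  set (H := fun r => flux r ^ 2 / 2 + b * flux r
     + p / (p + 1) * (rpow r b * rpow (1 + z r / p) (p + 1))).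
  assert (HH : H r <= H 0).
  { apply (nonincreasing_of_derive H (fun r =>
      - (Rpower r (1 + alpha) * f r) * flux r - b * (Rpower r (1 + alpha) * f r)
      + p / (p + 1) * (b * Rpower r (1 + alpha) * (f r * (1 + z r / p))
                       + r * Rpower r (1 + alpha) * ((p + 1) * f r * (z1 r / p)))));
      [lra | | |].
    - intros x Hx. assert (H1 := flux_derive x ltac:(lra)).
      assert (H2 := is_derive_rpow x b ltac:(lra)).
      assert (Hb := nonlinearity_base_range x ltac:(lra)).
      assert (H3 := is_derive_rpow (1 + z x / p) (p + 1) ltac:(lra)).
      assert (H4 := z_der x ltac:(lra)).
      unfold H. auto_derive.
      + repeat split; [eexists; exact H1 | eexists; exact H1 | eexists; exact H2
          | eexists; exact H3 | eexists; exact H4].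
      + rewrite (is_derive_unique (fun x : R => flux x) _ _ H1 : Derive (fun x : R => flux x) x = _).
        rewrite (is_derive_unique (fun x : R => z x) _ _ H4 : Derive (fun x : R => z x) x = _).
        rewrite (is_derive_unique _ _ _ H2 : Derive (fun x : R => rpow x b) x = _).
        change (z x * / p) with (z x / p).
        rewrite (is_derive_unique _ _ _ H3
                  : Derive (fun x : R => rpow x (p + 1)) (1 + z x / p) = _).
        replace (p + 1 - 1) with p by ring.
        replace (b - 1) with (1 + alpha) by (unfold b; ring).
        rewrite (rpow_Rpower _ (p + 1)), Rpower_S by lra.
        replace b with (1 + alpha + 1) at 3 by (unfold b; ring).
        rewrite rpow_S, rpow_Rpower by lra. unfold f. field. lra.
    - intros x Hx.
      assert (Cq := flux_continuous x ltac:(lra)). assert (Cz := z_cont x ltac:(lra)).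
      unfold H. apply continuous_plus_R; [apply continuous_plus_R |].
      + simpl. apply continuous_mult_R; [| apply continuous_const].
        apply (continuous_mult_R flux (fun x => flux x * 1)); [exact Cq |].
        apply (continuous_mult_R flux); [exact Cq | apply continuous_const].
      + apply continuous_mult_R; auto using continuous_const.
      + apply continuous_mult_R; [apply continuous_const |].
        apply continuous_mult_R; [apply continuous_rpow; unfold b; lra |].
        apply (continuous_comp (fun x => 1 + z x / p) (fun y => rpow y (p + 1)));
          [| apply continuous_rpow; lra].
        apply continuous_plus_R; [apply continuous_const |].
        apply continuous_mult_R; auto using continuous_const.
    - intros x Hx. assert (Hb := nonlinearity_base_range x ltac:(lra)).
      assert (F := nonlinearity_range x ltac:(lra)). assert (P0 := Rpower_gt0 x (1 + alpha)).
      (* The weight [p / (p + 1)] makes the two terms containing [z1] cancel. The remaining bracket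
         is nonnegative because [1 + z/p <= 1]. *)
      replace (- (Rpower x (1 + alpha) * f x) * flux x - b * (Rpower x (1 + alpha) * f x)
        + p / (p + 1) * (b * Rpower x (1 + alpha) * (f x * (1 + z x / p))
                       + x * Rpower x (1 + alpha) * ((p + 1) * f x * (z1 x / p))))
        with (- (b * (Rpower x (1 + alpha) * f x) * (1 - p / (p + 1) * (1 + z x / p))))
        by (unfold flux; field; lra).
      assert (0 <= b * (Rpower x (1 + alpha) * f x) * (1 - p / (p + 1) * (1 + z x / p)));
        [| lra].
      apply Rmult_le_pos.
      + apply Rmult_le_pos; [unfold b; lra | apply Rmult_le_pos; lra].
      + assert (0 < p / (p + 1)) by (apply Rdiv_lt_0_compat; lra).
        assert (p / (p + 1) <= 1) by (apply Rle_div_l; lra). nra. }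
  assert (H0 : H 0 = 0) by (unfold H; rewrite flux_0, (rpow_nonpos 0) by lra; unfold Rdiv; ring).
  assert (Hpos : 0 <= p / (p + 1) * (rpow r b * rpow (1 + z r / p) (p + 1))).
  { apply Rmult_le_pos; [left; apply Rdiv_lt_0_compat; lra |].
    apply Rmult_le_pos; apply rpow_ge0. }
  (* Dropping the nonnegative last term leaves [flux (flux / 2 + b) <= 0]; as [flux <= 0], this
     forces [flux >= - 2 b]. *)
  rewrite H0 in HH. unfold H in HH. assert (Hq := flux_le0 r ltac:(lra)).
  assert (b = 2 + alpha) by reflexivity. nra.
Qed.

(** The slope [- z1] is at most [2 (2+alpha) / r], so a descent of [p] takes a long logarithmic
    distance. The integration starts at 1 to avoid the singularity of [ln]; the descent before 1 is
    at most [1 / (2+alpha)^2] by [rescaled_lower]. *)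
Lemma ln_radius_lower : p - 1 / (2 + alpha) ^ 2 <= 2 * (2 + alpha) * ln S.
Proof.
  assert (HS1 := radius_gt1).
  enough (H : - z S - 2 * (2 + alpha) * ln S <= - z 1 - 2 * (2 + alpha) * ln 1).
  { assert (H1 := rescaled_lower 1 ltac:(lra)). rewrite rpow_Rpower in H1 by lra.
    unfold Rpower in H1. rewrite ln_1, Rmult_0_r, exp_0 in H1.
    rewrite ln_1, z_S in H. lra. }
  apply (nonincreasing_of_derive (fun r => - z r - 2 * (2 + alpha) * ln r)
    (fun r => - z1 r - 2 * (2 + alpha) / r)); [lra | | |].
  - intros x Hx. assert (H1 := z_der x ltac:(lra)). auto_derive.
    + repeat split; [eexists; exact H1 | lra].
    + rewrite (is_derive_unique (fun x : R => z x) _ _ H1 : Derive (fun x : R => z x) x = _).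
      field; lra.
  - intros x Hx. apply (continuous_minus (fun r => - z r) (fun r => 2 * (2 + alpha) * ln r)).
    + apply (continuous_opp z), z_cont; lra.
    + apply continuous_mult_R; [apply continuous_const |].
      apply (ex_derive_continuous ln). auto_derive; lra.
  - intros x Hx. rewrite rescaled_derivative_flux by lra. assert (H := flux_ge_total_mass x ltac:(lra)).
    replace (- (flux x / x) - 2 * (2 + alpha) / x) with (- ((flux x + 2 * (2 + alpha)) / x))
      by (field; lra).
    assert (0 <= (flux x + 2 * (2 + alpha)) / x) by (apply Rdiv_le_0_compat; lra). lra.
Qed.

(** Beyond [T] the flux stays below [flux T], so [z] falls at least as fast as [flux T * ln r],
    while its total fall is [p]. *)
Lemma ln_radius_upper T : 0 < T < S -> - flux T * ln S <= p - flux T * ln T.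
Proof.
  intros HT.
  enough (H : z S - flux T * ln S <= z T - flux T * ln T).
  { assert (H1 := rescaled_le0 T ltac:(lra)). rewrite z_S in H. lra. }
  apply (nonincreasing_of_derive (fun r => z r - flux T * ln r)
    (fun r => z1 r - flux T / r)); [lra | | |].
  - intros x Hx. assert (H1 := z_der x ltac:(lra)). auto_derive.
    + repeat split; [eexists; exact H1 | lra].
    + rewrite (is_derive_unique (fun x : R => z x) _ _ H1 : Derive (fun x : R => z x) x = _).
      field; lra.
  - intros x Hx. apply (continuous_minus z (fun r => flux T * ln r)).
    + apply z_cont; lra.
    + apply continuous_mult_R; [apply continuous_const |].
      apply (ex_derive_continuous ln). auto_derive; lra.
  - intros x Hx. rewrite rescaled_derivative_flux by lra.
    assert (H := flux_decreasing T x ltac:(lra) ltac:(lra)).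
    replace (flux x / x - flux T / x) with (- ((flux T - flux x) / x)) by (field; lra).
    assert (0 <= (flux T - flux x) / x) by (apply Rdiv_le_0_compat; lra). lra.
Qed.
End Rescaled.

(** * Comparison with the Liouville profile *)

Lemma radius_gt_of_Rpower (alpha p S A : R) (z z1 : R -> R) : 0 <= alpha -> 1 < p ->
  rescaled_solution alpha p S z z1 -> 0 < A -> Rpower A (2 + alpha) < p * (2 + alpha) ^ 2 -> A < S.
Proof.
  intros Ha Hp HS HA H. apply Rnot_le_lt. intros Hle.
  assert (H1 := radius_lower_bound alpha p S z z1 Ha Hp HS).
  assert (H2 : Rpower S (2 + alpha) <= Rpower A (2 + alpha)).
  { apply Rle_Rpower_l; [lra | split; [apply HS | exact Hle]]. }
  lra.
Qed.

(** [V exp (- L r) - K r] is nonincreasing. The differential inequality is asked only inside the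
    interval, since the equation is singular at 0. *)
Lemma gronwall_zero (V V1 : R -> R) (A L K : R) : 0 <= L -> 0 <= K ->
  (forall r, 0 <= r <= A -> continuous V r) ->
  (forall r, 0 < r < A -> is_derive V r (V1 r) /\ V1 r <= L * V r + K) ->
  V 0 = 0 -> forall r, 0 <= r <= A -> V r <= K * r * exp (L * r).
Proof.
  intros HL HK Hc Hd H0 r Hr.
  assert (H : V r * exp (- (L * r)) - K * r <= V 0 * exp (- (L * 0)) - K * 0).
  { apply (nonincreasing_of_derive (fun r => V r * exp (- (L * r)) - K * r)
      (fun r => (V1 r - L * V r) * exp (- (L * r)) - K)); [lra | | |].
    - intros x Hx. destruct (Hd x ltac:(lra)) as [H1 _]. auto_derive.
      + repeat split; eexists; exact H1.
      + rewrite (is_derive_unique (fun x : R => V x) _ _ H1 : Derive (fun x : R => V x) x = _).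
        ring.
    - intros x Hx.
      apply (continuous_minus (fun r => V r * exp (- (L * r))) (fun r => K * r)).
      + apply continuous_mult_R; [apply Hc; lra |].
        apply (ex_derive_continuous (fun r => exp (- (L * r)))). auto_derive; auto.
      + apply continuous_mult_R; [apply continuous_const | apply continuous_id].
    - intros x Hx. destruct (Hd x ltac:(lra)) as [_ H1].
      assert (E0 := exp_pos (- (L * x))).
      assert (E1 : exp (- (L * x)) <= 1).
      { rewrite <- exp_0. assert (0 <= L * x) by (apply Rmult_le_pos; lra).
        destruct (Req_dec (L * x) 0) as [-> | Hn]; [rewrite Ropp_0; lra |].
        left; apply exp_increasing; lra. }
      nra. }
  rewrite H0 in H.
  assert (E : exp (- (L * r)) * exp (L * r) = 1)
    by (rewrite <- exp_plus, Rplus_opp_l; apply exp_0).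
  assert (E0 := exp_pos (L * r)).
  replace (V r) with (V r * exp (- (L * r)) * exp (L * r))
    by (rewrite Rmult_assoc, E; ring).
  apply Rmult_le_compat_r; lra.
Qed.

(** The exponent [p ln (1 + z/p)] lies between [z - 2 z^2 / p] and [z], and the exponential is
    1-Lipschitz on nonpositive numbers. The condition [2 L < p] gives [z/p >= - 1/2], where
    [x - 2 x^2 <= ln (1 + x)]. *)
Lemma exp_approx (p L z : R) : 1 < p -> 2 * L < p -> - L <= z <= 0 ->
  Rabs (Rpower (1 + z / p) p - exp z) <= 2 * L ^ 2 / p.
Proof.
  intros Hp HL Hz.
  set (x := z / p). assert (Ex : x * p = z) by (unfold x; field; lra).
  assert (Hx : - (1 / 2) <= x <= 0).
  { split; apply Rmult_le_reg_r with p; lra. }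
  assert (Hl1 : ln (1 + x) <= x).
  { rewrite <- (ln_exp x) at 2. apply ln_le; [lra | apply exp_ineq1_le]. }
  assert (Hl2 : x - 2 * x ^ 2 <= ln (1 + x)).
  { assert (E := exp_ineq1_le (- ln (1 + x))).
    rewrite exp_Ropp, exp_ln in E by lra.
    assert (Ei : / (1 + x) <= 1 - x + 2 * x ^ 2); [| lra].
    apply Rmult_le_reg_r with (1 + x); [lra |]. rewrite Rinv_l by lra.
    assert (0 <= x ^ 2) by apply pow2_ge_0. nra. }
  set (d := 2 * L ^ 2 / p).
  assert (Hd : 2 * x ^ 2 * p <= d).
  { unfold d. apply Rmult_le_reg_r with p; [lra |].
    replace (2 * L ^ 2 / p * p) with (2 * L ^ 2) by (field; lra).
    replace (2 * x ^ 2 * p * p) with (2 * (x * p) ^ 2) by ring. rewrite Ex. nra. }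
  assert (Hd0 : 0 <= d).
  { unfold d. apply Rdiv_le_0_compat; [assert (H := pow2_ge_0 L) |]; lra. }
  assert (M1 : p * ln (1 + x) <= z) by nra.
  assert (M2 : z - d <= p * ln (1 + x)) by nra.
  assert (Mono : forall a b, a <= b -> exp a <= exp b).
  { intros a b [Hab | ->]; [left; apply exp_increasing, Hab | lra]. }
  apply Mono in M1, M2. change (exp (p * ln (1 + x))) with (Rpower (1 + x) p) in *.
  unfold Rminus in M2. rewrite exp_plus in M2.
  assert (E1 := exp_ineq1_le (- d)).
  assert (E2 : exp z <= 1) by (rewrite <- exp_0; apply Mono; lra).
  assert (E3 := exp_pos z).
  apply Rabs_le. split; nra.
Qed.

Lemma exp_lipschitz (a b : R) : a <= 0 -> b <= 0 -> Rabs (exp a - exp b) <= Rabs (a - b).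
Proof.
  assert (K : forall a b, b <= 0 -> a <= b -> 0 <= exp b - exp a <= b - a).
  { intros x y Hy Hxy.
    assert (E := exp_ineq1_le (x - y)).
    assert (E1 : exp x = exp y * exp (x - y)) by (rewrite <- exp_plus; f_equal; ring).
    assert (E2 : exp y <= 1).
    { rewrite <- exp_0. destruct Hy as [Hy | ->]; [left; apply exp_increasing, Hy | lra]. }
    assert (E3 := exp_pos y).
    assert (E4 : exp (x - y) <= 1).
    { rewrite <- exp_0. destruct Hxy as [H | ->]; [left; apply exp_increasing; lra |].
      rewrite Rminus_diag; lra. }
    nra. }
  intros Ha Hb. destruct (Rle_dec a b) as [H | H].
  - destruct (K a b Hb H). rewrite !Rabs_left1 by lra. lra.
  - destruct (K b a Ha ltac:(lra)). rewrite !Rabs_pos_eq by lra. lra.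
Qed.

(** Radial profile of [Ulim]: the solution of [(r U')' = - r^(1+alpha) e^U] with [U(0) = U'(0) = 0],
    to which the rescaled equation tends. *)
Definition liouville (alpha r : R) : R :=
  ln (4 * (2 + alpha) ^ 4 / (2 * (2 + alpha) ^ 2 + rpow r (2 + alpha)) ^ 2).

Definition liouville' (alpha r : R) : R :=
  - (2 * (2 + alpha)) * rpow r (1 + alpha) / (2 * (2 + alpha) ^ 2 + rpow r (2 + alpha)).

Section Liouville.
Variable alpha : R.
Hypothesis Ha : 0 <= alpha.

Lemma liouville_denominator_pos r : 0 < 2 * (2 + alpha) ^ 2 + rpow r (2 + alpha).
Proof.
  assert (H := rpow_ge0 r (2 + alpha)). assert (0 < (2 + alpha) ^ 2) by (apply pow_lt; lra). lra.
Qed.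

Lemma liouville_0 : liouville alpha 0 = 0.
Proof.
  unfold liouville. rewrite rpow_nonpos by lra.
  match goal with |- ln ?x = _ => replace x with 1 by (field; lra) end. apply ln_1.
Qed.

Lemma liouville'_0 : liouville' alpha 0 = 0.
Proof. unfold liouville'. rewrite (rpow_nonpos 0 (1 + alpha)) by lra. unfold Rdiv. ring. Qed.

Lemma exp_liouville r : exp (liouville alpha r)
  = 4 * (2 + alpha) ^ 4 / (2 * (2 + alpha) ^ 2 + rpow r (2 + alpha)) ^ 2.
Proof.
  apply exp_ln. assert (H := liouville_denominator_pos r).
  apply Rdiv_lt_0_compat; [| apply pow_lt, H].
  apply Rmult_lt_0_compat; [lra | apply pow_lt; lra].
Qed.

Lemma liouville_le0 r : liouville alpha r <= 0.
Proof.
  rewrite <- ln_1. unfold liouville. assert (H := liouville_denominator_pos r).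
  assert (H1 := rpow_ge0 r (2 + alpha)).
  assert (H2 : 0 < (2 + alpha) ^ 2) by (apply pow_lt; lra).
  apply ln_le.
  - apply Rdiv_lt_0_compat; [| apply pow_lt, H].
    apply Rmult_lt_0_compat; [lra | apply pow_lt; lra].
  - apply Rle_div_l; [apply pow_lt, H |]. nra.
Qed.

Lemma is_derive_rpow_ge0 r b : 1 < b -> 0 <= r ->
  is_derive (fun x => rpow x b) r (b * rpow r (b - 1)).
Proof.
  intros Hb [Hr | <-].
  - rewrite rpow_Rpower by auto. apply is_derive_rpow, Hr.
  - rewrite rpow_nonpos, Rmult_0_r by lra. apply is_derive_rpow_0, Hb.
Qed.

Lemma is_derive_liouville r : 0 <= r -> is_derive (liouville alpha) r (liouville' alpha r).
Proof.
  intros Hr. unfold liouville, liouville'.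
  assert (H := liouville_denominator_pos r).
  assert (H1 := is_derive_rpow_ge0 r (2 + alpha) ltac:(lra) Hr).
  assert (H2 : 0 < (2 + alpha) ^ 4) by (apply pow_lt; lra).
  auto_derive.
  - repeat split; [eexists; exact H1 | nra |].
    apply Rmult_lt_0_compat; [lra | apply Rinv_0_lt_compat; nra].
  - rewrite (is_derive_unique _ _ _ H1 : Derive (fun x : R => rpow x (2 + alpha)) r = _).
    replace (2 + alpha - 1) with (1 + alpha) by ring. field. split; nra.
Qed.

Lemma continuous_liouville r : 0 <= r -> continuous (liouville alpha) r.
Proof.
  intros Hr. apply (ex_derive_continuous (liouville alpha)).
  eexists; apply is_derive_liouville, Hr.
Qed.

Lemma continuous_liouville' r : continuous (liouville' alpha) r.
Proof.
  apply (continuous_mult_R (fun r => - (2 * (2 + alpha)) * rpow r (1 + alpha))).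
  - apply continuous_mult_R; [apply continuous_const | apply continuous_rpow; lra].
  - apply (continuous_comp (fun r => 2 * (2 + alpha) ^ 2 + rpow r (2 + alpha)) Rinv).
    + apply continuous_plus_R; [apply continuous_const | apply continuous_rpow; lra].
    + apply (continuous_Rinv). assert (H := liouville_denominator_pos r). lra.
Qed.

Lemma is_derive_liouville' r : 0 < r -> is_derive (liouville' alpha) r
  (- (liouville' alpha r / r) - Rpower r alpha * exp (liouville alpha r)).
Proof.
  intros Hr. rewrite exp_liouville. unfold liouville'.
  assert (H := liouville_denominator_pos r).
  assert (H1 := is_derive_rpow r (2 + alpha) Hr).
  assert (H3 := is_derive_rpow r (1 + alpha) Hr).
  auto_derive.
  - repeat split; [eexists; exact H3 | eexists; exact H1 | lra].
  - rewrite (is_derive_unique _ _ _ H1 : Derive (fun x : R => rpow x (2 + alpha)) r = _).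
    rewrite (is_derive_unique _ _ _ H3 : Derive (fun x : R => rpow x (1 + alpha)) r = _).
    replace (1 + alpha - 1) with alpha by ring.
    replace (2 + alpha - 1) with (1 + alpha) by ring.
    revert H. replace (2 + alpha) with (alpha + 1 + 1) by ring.
    replace (1 + alpha) with (alpha + 1) by ring.
    rewrite !rpow_S, !Rpower_S, !rpow_Rpower by auto. intros H.
    field. split; lra.
Qed.
End Liouville.

(* Gronwall for [w^2 + w'^2], [w = z - U]: the singular term [- w'/r] of [w''] has the good sign. *)
Lemma rescaled_solution_near_liouville (alpha A : R) : 0 <= alpha -> 0 < A ->
  exists C, forall p S z z1, 1 < p -> rescaled_solution alpha p S z z1 ->
    2 * (Rpower A (2 + alpha) / (2 + alpha) ^ 2) < p -> A < S /\
    forall r, 0 <= r <= A ->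
      (z r - liouville alpha r) ^ 2 + (z1 r - liouville' alpha r) ^ 2 <= C / p ^ 2.
Proof.
  intros Ha HA. set (L := Rpower A (2 + alpha) / (2 + alpha) ^ 2).
  set (K := Rpower A alpha). assert (HK : 0 < K) by apply Rpower_gt0.
  (* Gronwall rate: the 1 comes from [2 w w1 <= w^2 + w1^2], and [2 K] from
     [- 2 r^alpha w1 g <= K (w1^2 + g^2)] with [g^2 <= 2 w^2 + 2 d^2]. The source term left over is
     [2 K d^2] with [d = 2 L^2 / p], hence the factor [8 K L^4] below and the decay [1 / p^2]. *)
  set (M := 1 + 2 * K).
  assert (Hb2 : 0 < (2 + alpha) ^ 2) by (apply pow_lt; lra).
  exists (8 * K * L ^ 4 * A * exp (M * A)).
  intros p S z z1 Hp HS HLp.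
  assert (HAS : A < S).
  { apply (radius_gt_of_Rpower alpha p S A z z1); auto.
    assert (E : L * (2 + alpha) ^ 2 = Rpower A (2 + alpha)) by (unfold L; field; lra).
    assert (0 < Rpower A (2 + alpha)) by apply Rpower_gt0.
    assert (2 * L * (2 + alpha) ^ 2 < p * (2 + alpha) ^ 2) by (apply Rmult_lt_compat_r; lra).
    lra. }
  split; [exact HAS |]. intros r Hr.
  pose proof HS as [_ [z0 [z10 [_ [Hcont Hder]]]]].
  set (w := fun r => z r - liouville alpha r). set (w1 := fun r => z1 r - liouville' alpha r).
  set (V := fun r => w r ^ 2 + w1 r ^ 2).
  set (d := 2 * L ^ 2 / p).
  set (g := fun r => Rpower (1 + z r / p) p - exp (liouville alpha r)).
  assert (Hg : forall r, 0 < r < A -> g r ^ 2 <= 2 * w r ^ 2 + 2 * d ^ 2).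
  { intros x Hx.
    assert (Hz0 : z x <= 0) by (apply (rescaled_le0 alpha p S z z1 HS); lra).
    assert (HzL : - L <= z x).
    { assert (H := rescaled_lower alpha p S z z1 Ha Hp HS x ltac:(lra)).
      rewrite rpow_Rpower in H by lra.
      assert (Rpower x (2 + alpha) <= Rpower A (2 + alpha)) by (apply Rle_Rpower_l; lra).
      assert (Rpower x (2 + alpha) / (2 + alpha) ^ 2 <= L); [| lra].
      unfold L, Rdiv. apply Rmult_le_compat_r; [left; apply Rinv_0_lt_compat |]; lra. }
    assert (G1 := exp_approx p L (z x) Hp HLp (conj HzL Hz0)). fold d in G1.
    assert (G2 := exp_lipschitz (z x) (liouville alpha x) Hz0 (liouville_le0 alpha Ha x)).
    fold (w x) in G2.
    assert (G3 : Rabs (g x) <= d + Rabs (w x)).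
    { replace (g x) with ((Rpower (1 + z x / p) p - exp (z x))
                          + (exp (z x) - exp (liouville alpha x))) by (unfold g; ring).
      eapply Rle_trans; [apply Rabs_triang | lra]. }
    rewrite <- (pow2_abs (g x)), <- (pow2_abs (w x)).
    assert (P0 := Rabs_pos (g x)). assert (P1 := Rabs_pos (w x)).
    assert (Q : Rabs (g x) ^ 2 <= (d + Rabs (w x)) ^ 2) by (apply pow_incr; lra).
    assert (Q1 := pow2_ge_0 (d - Rabs (w x))). lra. }
  assert (HV : V r <= 2 * K * d ^ 2 * r * exp (M * r)).
  { apply (gronwall_zero V (fun r => 2 * w r * w1 r
        + 2 * w1 r * (- (w1 r / r) - Rpower r alpha * g r)) A); auto.
    - unfold M; lra.
    - assert (H := pow2_ge_0 d). apply Rmult_le_pos; lra.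
    - intros x Hx. destruct (Hcont x ltac:(lra)) as [C1 C2].
      assert (D1 : continuous w x)
        by (apply (continuous_minus z (liouville alpha)); [auto | apply continuous_liouville; lra]).
      assert (D2 : continuous w1 x)
        by (apply (continuous_minus z1 (liouville' alpha)); [auto | apply continuous_liouville'; lra]).
      unfold V. simpl.
      apply continuous_plus_R; repeat apply (continuous_mult_R _ _ x); auto using continuous_const.
    - intros x Hx. destruct (Hder x ltac:(lra)) as [_ [D1 D2]].
      assert (W : is_derive w x (w1 x)).
      { apply (is_derive_minus z (liouville alpha)); [exact D1 | apply is_derive_liouville; lra]. }
      assert (W1 : is_derive w1 x (- (w1 x / x) - Rpower x alpha * g x)).
      { replace (- (w1 x / x) - Rpower x alpha * g x) with
          (minus (- (z1 x / x) - Rpower x alpha * Rpower (1 + z x / p) p)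
            (- (liouville' alpha x / x) - Rpower x alpha * exp (liouville alpha x)))
          by (unfold minus, plus, opp, w1, g; simpl; field; lra).
        apply (is_derive_minus z1 (liouville' alpha)); [exact D2 | apply is_derive_liouville'; lra]. }
      split.
      + unfold V. auto_derive.
        * repeat split; eexists; [exact W | exact W1].
        * rewrite (is_derive_unique (fun x : R => w x) _ _ W : Derive (fun x : R => w x) x = _).
          rewrite (is_derive_unique (fun x : R => w1 x) _ _ W1 : Derive (fun x : R => w1 x) x = _).
          ring.
      + assert (Hk : 0 < Rpower x alpha <= K)
          by (split; [apply Rpower_gt0 | apply Rle_Rpower_l; lra]).
        assert (G := Hg x Hx). set (k := Rpower x alpha) in *.
        assert (T1 : 0 <= w1 x * w1 x / x).
        { apply Rdiv_le_0_compat; [apply Rle_0_sqr | lra]. }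
        assert (T2 : - (2 * w1 x * (k * g x)) <= K * (w1 x ^ 2 + g x ^ 2)).
        { assert (S1 := pow2_ge_0 (w1 x + g x)). assert (S2 := pow2_ge_0 (w1 x)).
          assert (S3 := pow2_ge_0 (g x)).
          apply Rle_trans with (k * (w1 x ^ 2 + g x ^ 2)); [nra |].
          apply Rmult_le_compat_r; lra. }
        assert (T3 := pow2_ge_0 (w x - w1 x)).
        assert (T4 : K * g x ^ 2 <= K * (2 * w x ^ 2 + 2 * d ^ 2))
          by (apply Rmult_le_compat_l; lra).
        assert (T5 : 0 <= K * w1 x ^ 2) by (apply Rmult_le_pos; [lra | apply pow2_ge_0]).
        replace (2 * w1 x * (- (w1 x / x) - k * g x))
          with (- 2 * (w1 x * w1 x / x) - 2 * w1 x * (k * g x)) by (field; lra).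
        unfold M, V. lra.
    - unfold V, w, w1. rewrite z0, z10, liouville_0, liouville'_0 by auto. ring. }
  eapply Rle_trans; [exact HV |].
  replace (8 * K * L ^ 4 * A * exp (M * A) / p ^ 2) with (2 * K * d ^ 2 * A * exp (M * A))
    by (unfold d; field; lra).
  assert (Hd := pow2_ge_0 d). assert (HM : 0 < M) by (unfold M; lra).
  assert (E : exp (M * r) <= exp (M * A)).
  { destruct (Req_dec r A) as [-> | Hn]; [lra |].
    left; apply exp_increasing. apply Rmult_lt_compat_l; lra. }
  apply Rmult_le_compat; [| left; apply exp_pos | | exact E].
  - apply Rmult_le_pos; [apply Rmult_le_pos |]; lra.
  - apply Rmult_le_compat_l; [apply Rmult_le_pos |]; lra.
Qed.

(** * Asymptotics *)

Lemma ln_Rpower (x y : R) : ln (Rpower x y) = y * ln x.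
Proof. unfold Rpower. apply ln_exp. Qed.

Lemma rho_pos (alpha p : R) (v : R -> R) : 0 < rho alpha p v.
Proof. apply Rpower_gt0. Qed.

Lemma ln_inv_rho (alpha p : R) (v : R -> R) : 0 <= alpha -> 1 < p ->
  (2 + alpha) * ln (1 / rho alpha p v) = ln p + (p - 1) * ln (mu v).
Proof.
  intros Ha Hp. unfold Rdiv. rewrite Rmult_1_l, ln_Rinv by apply rho_pos.
  unfold rho. rewrite ln_Rpower, ln_mult, ln_Rpower; [| lra | apply Rpower_gt0]. field. lra.
Qed.

(** The normalization behind [rho]: with it the rescaled equation has coefficient 1 in front of the
    nonlinearity. *)
Lemma rho_spec (alpha p : R) (v : R -> R) : 0 <= alpha -> 1 < p -> 0 < v 0 ->
  Rpower (rho alpha p v) (2 + alpha) * (p * Rpower (v 0) (p - 1)) = 1.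
Proof.
  intros Ha Hp Hv. unfold rho, mu. rewrite Rpower_mult, (Rabs_pos_eq (v 0)) by lra.
  set (X := p * Rpower (v 0) (p - 1)).
  assert (HX : 0 < X) by (apply Rmult_lt_0_compat; [lra | apply Rpower_gt0]).
  replace (- (1 / (2 + alpha)) * (2 + alpha)) with (- (1)) by (field; lra).
  rewrite Rpower_Ropp, Rpower_1 by auto. field. lra.
Qed.

Definition rescaled_profile (alpha p : R) (v : R -> R) (r : R) : R :=
  p * (v (rho alpha p v * r) - v 0) / v 0.

(** The second conjunct adds the derivative at [r = 0], which [rescaled_solution] leaves out and the
    partial derivatives at the origin of the plane require. *)
Lemma least_energy_rescaled_solution (alpha p : R) (v : R -> R) : 0 <= alpha -> 1 < p ->
  pos_least_energy_radial alpha p v ->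
  exists z1, rescaled_solution alpha p (1 / rho alpha p v) (rescaled_profile alpha p v) z1 /\
    forall r, 0 <= r < 1 / rho alpha p v -> is_derive (rescaled_profile alpha p v) r (z1 r).
Proof.
  intros Ha Hp Hle.
  destruct (least_energy_euler_lagrange alpha p v Ha Hp Hle) as [v' [Hv [Hv'0 Hode]]].
  destruct Hle as [_ Hpos].
  assert (H0 : 0 < v 0) by (apply Hpos; lra).
  assert (Hrho := rho_pos alpha p v). assert (Hspec := rho_spec alpha p v Ha Hp H0).
  set (rh := rho alpha p v) in *. set (S := 1 / rh).
  assert (HrS : rh * S = 1) by (unfold S; field; lra).
  assert (HS : 0 < S) by (apply Rdiv_lt_0_compat; lra).
  assert (Hin : forall r, 0 <= r <= S -> 0 <= rh * r <= 1).
  { intros r Hr. split; [apply Rmult_le_pos; lra |].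
    rewrite <- HrS. apply Rmult_le_compat_l; lra. }
  assert (Hin' : forall r, 0 < r < S -> 0 < rh * r < 1).
  { intros r Hr. split; [apply Rmult_lt_0_compat; lra |].
    rewrite <- HrS. apply Rmult_lt_compat_l; lra. }
  set (z1 := fun r => p * rh * v' (rh * r) / v 0).
  assert (Hz : forall r, 0 <= r <= S -> is_derive (rescaled_profile alpha p v) r (z1 r)).
  { intros r Hr. destruct Hv as [Hv _]. destruct (Hv _ (Hin r Hr)) as [D _].
    apply is_derive_Reals in D. unfold rescaled_profile, z1. fold rh. auto_derive.
    - repeat split; eexists; exact D.
    - rewrite (is_derive_unique (fun x : R => v x) _ _ D
                : Derive (fun x : R => v x) (rh * r) = _). field. lra. }
  exists z1. split; [| intros r Hr; apply Hz; lra].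
  split; [exact HS |]. unfold rescaled_profile at 1 2. fold rh.
  split; [rewrite Rmult_0_r; field; lra |].
  split; [unfold z1; rewrite Rmult_0_r, Hv'0; field; lra |].
  split; [rewrite HrS; destruct Hv as [_ ->]; field; lra |].
  split.
  - intros r Hr. split.
    + apply (ex_derive_continuous (rescaled_profile alpha p v)). eexists; apply Hz, Hr.
    + unfold z1. apply continuous_mult_R; [| apply continuous_const].
      apply continuous_mult_R; [apply continuous_const |].
      apply (continuous_comp (fun r => rh * r) v').
      * apply continuous_mult_R; [apply continuous_const | apply continuous_id].
      * apply (profile_continuous v v' _ Hv (Hin r Hr)).
  - intros r Hr. assert (Hx := Hin' r Hr).
    assert (Hvr : 0 < v (rh * r)) by (apply Hpos; lra).
    split; [| split; [apply Hz; lra |]].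
    + unfold rescaled_profile. fold rh.
      replace (p * (v (rh * r) - v 0) / v 0) with (p * (v (rh * r) / v 0) - p) by (field; lra).
      assert (0 < p * (v (rh * r) / v 0)); [| lra].
      apply Rmult_lt_0_compat; [lra | apply Rdiv_lt_0_compat; lra].
    + assert (D := Hode _ Hx). unfold z1. auto_derive.
      * repeat split; eexists; exact D.
      * rewrite (is_derive_unique (fun x : R => v' x) _ _ D
                  : Derive (fun x : R => v' x) (rh * r) = _).
        unfold rescaled_profile. fold rh.
        replace (1 + p * (v (rh * r) - v 0) / v 0 / p) with (v (rh * r) / v 0) by (field; lra).
        assert (E1 : Rpower (v (rh * r)) p = Rpower (v 0) p * Rpower (v (rh * r) / v 0) p).
        { rewrite Rpower_mult_distr; [| lra | apply Rdiv_lt_0_compat; lra].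
          f_equal. field; lra. }
        rewrite E1, <- Rpower_mult_distr by lra.
        replace (2 + alpha) with (alpha + 1 + 1) in Hspec by ring.
        rewrite !Rpower_S in Hspec by auto.
        assert (E2 : Rpower (v 0) p = Rpower (v 0) (p - 1) * v 0)
          by (rewrite <- Rpower_S by auto; f_equal; ring).
        rewrite E2.
        set (Q := Rpower (v (rh * r) / v 0) p) in *.
        set (W := Rpower (v 0) (p - 1)) in *. set (A := Rpower rh alpha) in *.
        replace (Rpower r alpha * Q) with (Rpower r alpha * Q * (A * rh * rh * (p * W)))
          by (rewrite Hspec; ring).
        field. repeat split; lra.
Qed.

(** * From radial profiles to partial derivatives in the plane *)

Lemma normR2_sym (x y : R) : normR2 x y = normR2 y x.
Proof. unfold normR2. f_equal. ring. Qed.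

Lemma normR2_ge0 (x y : R) : 0 <= normR2 x y.
Proof. apply sqrt_pos. Qed.

Lemma abs_le_normR2 (x y : R) : Rabs x <= normR2 x y.
Proof.
  unfold normR2. rewrite <- sqrt_Rsqr_abs. apply sqrt_le_1_alt. unfold Rsqr. nra.
Qed.

(* At the origin [x / normR2 x y] is the junk value [0 / 0], harmless since [f1 = 0] there. *)
Lemma radial_partial_derivative (f : R -> R) (f1 x y : R) :
  is_derive f (normR2 x y) f1 -> (normR2 x y = 0 -> f1 = 0) ->
  derivable_pt_lim (fun t => f (normR2 t y)) x (f1 * (x / normR2 x y)).
Proof.
  intros Hf H0. destruct (normR2_ge0 x y) as [Hr | Hr].
  - assert (Hxy : 0 < x * x + y * y).
    { apply Rnot_le_lt. intros H. unfold normR2 in Hr. rewrite sqrt_neg_0 in Hr; lra. }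
    apply is_derive_Reals.
    replace (f1 * (x / normR2 x y)) with (scal (x / normR2 x y) f1)
      by (unfold scal; simpl; unfold mult; simpl; ring).
    apply (is_derive_comp f (fun t => normR2 t y)); [exact Hf |].
    unfold normR2 in *. auto_derive; [lra |]. field. lra.
  - symmetry in Hr. rewrite (H0 Hr) in *.
    assert (Hx : x = 0).
    { assert (H := abs_le_normR2 x y). rewrite Hr in H. apply Rabs_eq_0.
      assert (H1 := Rabs_pos x). lra. }
    assert (Hy : y = 0).
    { assert (H := abs_le_normR2 y x). rewrite normR2_sym, Hr in H. apply Rabs_eq_0.
      assert (H1 := Rabs_pos y). lra. }
    subst x y. rewrite Rmult_0_l.
    (* At the origin the difference quotient of [f (|t|)] at [h] has the same modulus as that of [f]
       at [|h|], which tends to [f1 = 0]. *)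
    assert (HN : forall t, normR2 t 0 = Rabs t).
    { intros t. unfold normR2. rewrite Rmult_0_r, Rplus_0_r. apply sqrt_Rsqr_abs. }
    rewrite Hr in Hf. apply is_derive_Reals in Hf.
    intros eps He. destruct (Hf eps He) as [d Hd]. exists d. intros h Hh Hhd.
    rewrite !HN, Rplus_0_l, Rabs_R0.
    assert (Hah : Rabs h <> 0) by (apply Rabs_no_R0, Hh).
    specialize (Hd (Rabs h) Hah). rewrite Rabs_Rabsolu, Rplus_0_l, Rminus_0_r in Hd.
    specialize (Hd Hhd). rewrite Rminus_0_r.
    unfold Rdiv in *. rewrite Rabs_mult, Rabs_inv in *. rewrite Rabs_Rabsolu in Hd. exact Hd.
Qed.

Lemma C1_close_of_radial (f g : R -> R) (f1 g1 x y eps : R) : 0 < eps ->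
  is_derive f (normR2 x y) f1 -> is_derive g (normR2 x y) g1 ->
  (normR2 x y = 0 -> f1 = 0 /\ g1 = 0) -> Rabs (f1 - g1) < eps ->
  exists a b, derivable_pt_lim (fun t => f (normR2 t y)) x a /\
              derivable_pt_lim (fun t => g (normR2 t y)) x b /\ Rabs (a - b) < eps.
Proof.
  intros He Hf Hg H0 Hfg. exists (f1 * (x / normR2 x y)), (g1 * (x / normR2 x y)).
  split; [apply radial_partial_derivative; [exact Hf | apply H0] |].
  split; [apply radial_partial_derivative; [exact Hg | apply H0] |].
  rewrite <- Rmult_minus_distr_r, Rabs_mult.
  destruct (normR2_ge0 x y) as [Hr | Hr].
  - assert (H : Rabs (x / normR2 x y) <= 1).
    { unfold Rdiv. rewrite Rabs_mult, Rabs_inv, (Rabs_pos_eq (normR2 x y)) by lra.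
      apply Rle_div_l; [exact Hr |]. rewrite Rmult_1_l. apply abs_le_normR2. }
    assert (H1 := Rabs_pos (f1 - g1)). assert (H2 := Rabs_pos (x / normR2 x y)). nra.
  - destruct (H0 (eq_sym Hr)) as [-> ->]. rewrite Rminus_0_r, Rabs_R0. lra.
Qed.

(** * Limits as [p] tends to infinity *)

Lemma sum_sqr_lt_abs (a b eps : R) : 0 < eps -> a ^ 2 + b ^ 2 < eps ^ 2 ->
  Rabs a < eps /\ Rabs b < eps.
Proof.
  intros He H. assert (Ha := pow2_ge_0 a). assert (Hb := pow2_ge_0 b).
  split; rewrite <- (Rabs_pos_eq eps) by lra; apply Rsqr_lt_abs_0; rewrite !Rsqr_pow2; lra.
Qed.

Lemma rescaled_solution_converges (alpha A eps : R) : 0 <= alpha -> 0 < A -> 0 < eps ->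
  exists P, forall p S z z1, p > P -> 1 < p -> rescaled_solution alpha p S z z1 ->
    A < S /\ forall r, 0 <= r <= A ->
      Rabs (z r - liouville alpha r) < eps /\ Rabs (z1 r - liouville' alpha r) < eps.
Proof.
  intros Ha HA He.
  destruct (rescaled_solution_near_liouville alpha A Ha HA) as [C H].
  exists (Rmax (2 * (Rpower A (2 + alpha) / (2 + alpha) ^ 2)) (C / eps ^ 2)).
  intros p S z z1 HP Hp HS.
  assert (HP1 := Rmax_l (2 * (Rpower A (2 + alpha) / (2 + alpha) ^ 2)) (C / eps ^ 2)).
  assert (HP2 := Rmax_r (2 * (Rpower A (2 + alpha) / (2 + alpha) ^ 2)) (C / eps ^ 2)).
  destruct (H p S z z1 Hp HS ltac:(lra)) as [HAS Hr]. split; [exact HAS |].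
  intros r Hrr. apply sum_sqr_lt_abs; [exact He |].
  eapply Rle_lt_trans; [apply Hr, Hrr |].
  assert (He2 : 0 < eps ^ 2) by (apply pow_lt, He).
  apply Rlt_div_l; [apply pow_lt; lra |].
  assert (HC2 : C < p * eps ^ 2) by (apply Rlt_div_l; lra).
  assert (p * eps ^ 2 <= p ^ 2 * eps ^ 2) by (apply Rmult_le_compat_r; nra). lra.
Qed.

Lemma ln_eventually_small (eps : R) : 0 < eps ->
  exists P, 1 < P /\ forall p, p > P -> ln p <= eps * (p - 1).
Proof.
  (* From [1 + ln y <= y] at [y = p eps / 2]; beyond [P0] the other half of [eps p] absorbs [eps]
     and [- ln (eps / 2)]. *)
  intros He. set (P0 := 2 * (eps + Rabs (ln (eps / 2))) / eps).
  exists (Rmax 2 P0). split; [assert (H := Rmax_l 2 P0); lra |].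
  intros p Hp. assert (H1 := Rmax_l 2 P0). assert (H2 := Rmax_r 2 P0).
  assert (E := exp_ineq1_le (ln (p * (eps / 2)))).
  rewrite exp_ln in E by (apply Rmult_lt_0_compat; lra).
  rewrite ln_mult in E by lra.
  assert (H3 : P0 * eps = 2 * (eps + Rabs (ln (eps / 2)))) by (unfold P0; field; lra).
  assert (H4 : P0 * eps <= p * eps) by (apply Rmult_le_compat_r; lra).
  assert (H5 := Rle_abs (- ln (eps / 2))). rewrite Rabs_Ropp in H5. lra.
Qed.

(* [-T z'(T) -> -T U'(T)], which is close to the total mass [2 (2 + alpha)] for large [T]. *)
Lemma rescaled_mass_eventually (alpha eta : R) : 0 <= alpha -> 0 < eta ->
  exists T P, 1 < T /\ forall p S z z1, p > P -> 1 < p -> rescaled_solution alpha p S z z1 ->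
    T < S /\ 2 * (2 + alpha) * (1 - eta) <= - (T * z1 T).
Proof.
  intros Ha He. set (b := 2 + alpha). assert (Hb : 2 <= b) by (unfold b; lra).
  (* [X] is the value of [T^b]. The relative mass of [U] outside radius [T] is
     [2 b^2 / (2 b^2 + X)], made at most [eta / 2] by this choice. *)
  set (X := 1 + 4 * b ^ 2 / eta).
  assert (Hb2 : 0 < b ^ 2) by (apply pow_lt; lra).
  assert (HX0 : 0 < 4 * b ^ 2 / eta) by (apply Rdiv_lt_0_compat; lra).
  assert (HX : 1 < X) by (unfold X; lra).
  set (T := Rpower X (1 / b)).
  assert (HTb : Rpower T b = X) by (apply Rpower_inv_exponent; lra).
  assert (HT : 1 < T).
  { unfold T. rewrite <- (Rpower_O X) at 1 by lra. apply Rpower_lt; [lra |].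
    apply Rdiv_lt_0_compat; lra. }
  (* The tolerance on [z1] is multiplied by [T] in the flux; the resulting error [b eta] is the
     other half of the allowed loss [2 b eta]. *)
  assert (He' : 0 < b * eta / T) by (apply Rdiv_lt_0_compat; [apply Rmult_lt_0_compat |]; lra).
  destruct (rescaled_solution_converges alpha T (b * eta / T) Ha ltac:(lra) He') as [P HP].
  exists T, P. split; [exact HT |].
  intros p S z z1 Hp Hp1 HS. destruct (HP p S z z1 Hp Hp1 HS) as [HTS Hr].
  split; [exact HTS |]. destruct (Hr T ltac:(lra)) as [_ Hz1].
  assert (HU : T * liouville' alpha T = - (2 * b) * X / (2 * b ^ 2 + X)).
  { assert (HX1 : rpow T (1 + alpha) * T = X).
    { rewrite <- rpow_S, rpow_Rpower, <- HTb by lra. f_equal. unfold b. ring. }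
    unfold liouville'. fold b. rewrite (rpow_Rpower T b), HTb, <- HX1 by lra.
    field. rewrite HX1. lra. }
  assert (HU2 : 2 * b * (1 - eta / 2) <= - (T * liouville' alpha T)).
  { rewrite HU.
    replace (- (- (2 * b) * X / (2 * b ^ 2 + X))) with (2 * b * (1 - 2 * b ^ 2 / (2 * b ^ 2 + X)))
      by (field; lra).
    apply Rmult_le_compat_l; [lra |].
    assert (2 * b ^ 2 / (2 * b ^ 2 + X) <= eta / 2); [| lra].
    apply Rle_div_l; [lra |].
    assert (EX : eta * (X - 1) = 4 * b ^ 2) by (unfold X; field; lra). nra. }
  apply Rabs_def2 in Hz1.
  assert (HTz : T * (z1 T - liouville' alpha T) <= T * (b * eta / T))
    by (apply Rmult_le_compat_l; lra).
  replace (T * (b * eta / T)) with (b * eta) in HTz by (field; lra). lra.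
Qed.

Lemma ln_mu_converges (alpha : R) (u : R -> R -> R) (eps : R) : 0 <= alpha -> 0 < eps ->
  (forall p, 1 < p -> pos_least_energy_radial alpha p (u p)) ->
  exists P, forall p, p > P -> Rabs (ln (mu (u p)) - 1 / 2) <= eps.
Proof.
  (* The final error is [2 eta (p - 1)], hence [eps / 2]. The bound [1/4] gives
     [1 / (2 (1 - eta)) <= 1/2 + eta], used for [b / M], and [1/2 + eta <= 1], which accounts for
     the 1 in [P3]. *)
  intros Ha He Hu. set (eta := Rmin (eps / 2) (1 / 4)).
  assert (Heta : 0 < eta) by (apply Rmin_glb_lt; lra).
  assert (Heta1 : eta <= eps / 2) by apply Rmin_l.
  assert (Heta2 : eta <= 1 / 4) by apply Rmin_r.
  destruct (rescaled_mass_eventually alpha eta Ha Heta) as [T [P1 [HT HP1]]].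
  destruct (ln_eventually_small eps He) as [P2 [HP20 HP2]].
  set (b := 2 + alpha). assert (Hb : 2 <= b) by (unfold b; lra).
  assert (HlT : 0 < ln T) by (rewrite <- ln_1; apply ln_increasing; lra).
  set (P3 := 1 + (1 + b * ln T) / eta).
  exists (Rmax P1 (Rmax P2 P3)). intros p Hp.
  assert (Q1 := Rmax_l P1 (Rmax P2 P3)). assert (Q2 := Rmax_r P1 (Rmax P2 P3)).
  assert (Q3 := Rmax_l P2 P3). assert (Q4 := Rmax_r P2 P3).
  assert (Hp1 : 1 < p) by lra.
  destruct (least_energy_rescaled_solution alpha p (u p) Ha Hp1 (Hu p Hp1)) as [z1 [HS _]].
  set (S := 1 / rho alpha p (u p)) in *.
  assert (HlnS : b * ln S = ln p + (p - 1) * ln (mu (u p))) by (apply ln_inv_rho; auto).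
  destruct (HP1 p S _ z1 ltac:(lra) Hp1 HS) as [HTS HM].
  assert (Low := ln_radius_lower alpha p S _ z1 Ha Hp1 HS).
  assert (Up := ln_radius_upper alpha p S _ z1 HS T ltac:(lra)).
  fold b in Low, HM. set (M := - (T * z1 T)) in *.
  replace (- (T * z1 T) * ln S) with (M * ln S) in Up by (unfold M; ring).
  assert (HM0 : 0 < M) by nra.
  assert (Hlp := HP2 p ltac:(lra)).
  assert (Hlp0 : 0 <= ln p) by (rewrite <- ln_1; apply ln_le; lra).
  assert (Hb1 : 1 / b ^ 2 <= 1) by (apply Rle_div_l; nra).
  set (l := ln (mu (u p))) in *.
  apply Rabs_le. split.
  (* [Low] gives [(p - 1) l >= p/2 - 1 / (2 b^2) - ln p]; the difference between [p/2] and
     [(p - 1)/2] pays for [1 / (2 b^2)]. *)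
  - assert (H : - eps * (p - 1) <= (l - 1 / 2) * (p - 1)) by nra.
    apply Rmult_le_reg_r in H; lra.
  - assert (HlS : ln S - ln T <= p / M).
    { apply Rle_div_r; [exact HM0 |]. unfold M in *. nra. }
    assert (HpM : b * (p / M) <= p * (1 / 2 + eta)).
    { replace (b * (p / M)) with (p * (b / M)) by (field; lra).
      apply Rmult_le_compat_l; [lra |]. apply Rle_div_l; [exact HM0 |].
      assert (HMe : (1 / 2 + eta) * (2 * b * (1 - eta)) <= (1 / 2 + eta) * M)
        by (apply Rmult_le_compat_l; lra).
      assert (0 <= b * (eta * (1 - 2 * eta))) by (repeat apply Rmult_le_pos; lra). nra. }
    assert (Hub : (p - 1) * l <= p * (1 / 2 + eta) + b * ln T).
    { assert (b * (ln S - ln T) <= b * (p / M)) by (apply Rmult_le_compat_l; lra). lra. }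
    assert (HP3 : 1 + b * ln T <= (p - 1) * eta).
    { assert (E : (P3 - 1) * eta = 1 + b * ln T) by (unfold P3; field; lra).
      assert ((P3 - 1) * eta <= (p - 1) * eta) by (apply Rmult_le_compat_r; lra). lra. }
    assert (H : (l - 1 / 2) * (p - 1) <= eps * (p - 1)) by nra.
    apply Rmult_le_reg_r in H; lra.
Qed.

Theorem theorem1p1 (alpha : R) (halpha : 0 <= alpha) (u : R -> R -> R)
  (hu : forall p, 1 < p -> pos_least_energy_radial alpha p (u p)) :
  (forall eps, 0 < eps -> exists P, forall p, p > P ->
      Rabs (mu (u p) - sqrt (exp 1)) < eps) /\
  (forall eps, 0 < eps -> exists P, forall p, p > P ->
      Rabs (rho alpha p (u p)) < eps) /\
  C1loc_conv_infty
    (fun p x y => normR2 x y < 1 / rho alpha p (u p))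
    (fun p => utilde alpha p (u p)) (Ulim alpha).
Proof.
  split; [| split].
  - intros eps He.
    assert (Hc : continuous exp (1 / 2)).
    { apply (ex_derive_continuous exp). eexists. apply is_derive_exp. }
    destruct (Hc (fun y => Rabs (y - exp (1 / 2)) < eps)) as [d Hd].
    { exists (mkposreal eps He). intros y Hy. exact Hy. }
    assert (Hd0 := cond_pos d).
    destruct (ln_mu_converges alpha u (d / 2) halpha ltac:(lra) hu) as [P HP].
    exists (Rmax 1 P). intros p Hp.
    assert (Q1 := Rmax_l 1 P). assert (Q2 := Rmax_r 1 P).
    assert (Hmu : 0 < mu (u p)).
    { apply Rabs_pos_lt. apply Rgt_not_eq, (hu p ltac:(lra)). lra. }
    replace (sqrt (exp 1)) with (exp (1 / 2)).
    + rewrite <- (exp_ln (mu (u p))) by auto. apply Hd.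
      apply Rle_lt_trans with (d / 2); [apply HP; lra | lra].
    + symmetry. apply sqrt_lem_1; [left; apply exp_pos .. |].
      rewrite <- exp_plus. f_equal. field.
  - intros eps He.
    (* For the radius [1 / eps] the conclusion [A < S] reads [1 / eps < 1 / rho]. *)
    destruct (rescaled_solution_converges alpha (1 / eps) 1 halpha) as [P HP];
      [apply Rdiv_lt_0_compat; lra | lra |].
    exists (Rmax 1 P). intros p Hp.
    assert (Q1 := Rmax_l 1 P). assert (Q2 := Rmax_r 1 P). assert (Hp1 : 1 < p) by lra.
    destruct (least_energy_rescaled_solution alpha p (u p) halpha Hp1 (hu p Hp1)) as [z1 [HS _]].
    destruct (HP p _ _ _ ltac:(lra) Hp1 HS) as [H _].
    assert (Hr := rho_pos alpha p (u p)). rewrite Rabs_pos_eq by lra.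
    apply Rnot_le_lt. intros Hle. apply (Rinv_le_contravar _ _ He) in Hle. lra.
  - intros Rad eps HRad He.
    destruct (rescaled_solution_converges alpha Rad eps halpha HRad He) as [P HP].
    exists (Rmax 1 P). intros p Hp x y Hxy.
    assert (Q1 := Rmax_l 1 P). assert (Q2 := Rmax_r 1 P). assert (Hp1 : 1 < p) by lra.
    destruct (least_energy_rescaled_solution alpha p (u p) halpha Hp1 (hu p Hp1))
      as [z1 [HS Hz]].
    destruct (HP p _ _ _ ltac:(lra) Hp1 HS) as [HRS Hclose].
    assert (Hn : 0 <= normR2 x y <= Rad).
    { split; [apply normR2_ge0 |]. rewrite <- (sqrt_square Rad) by lra.
      apply sqrt_le_1_alt, Hxy. }
    destruct (Hclose _ Hn) as [H1 H2].
    assert (Hz0 : z1 0 = 0) by apply HS.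
    assert (Hdz := Hz (normR2 x y) ltac:(lra)).
    assert (HdU := is_derive_liouville alpha halpha (normR2 x y) (proj1 Hn)).
    assert (Horig : normR2 x y = 0 ->
      z1 (normR2 x y) = 0 /\ liouville' alpha (normR2 x y) = 0).
    { intros ->. split; [exact Hz0 | apply liouville'_0]. }
    split; [lra | split; [exact H1 | split]].
    + exact (C1_close_of_radial _ _ _ _ x y eps He Hdz HdU Horig H2).
    + rewrite (normR2_sym x y) in Hdz, HdU, Horig, H2.
      destruct (C1_close_of_radial _ _ _ _ y x eps He Hdz HdU Horig H2) as [a [b [Da [Db Hab]]]].
      exists a, b. split; [| split; [| exact Hab]]; apply is_derive_Reals.
      * apply is_derive_Reals in Da. apply is_derive_ext with (2 := Da).
        intros t. rewrite normR2_sym. reflexivity.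
      * apply is_derive_Reals in Db. apply is_derive_ext with (2 := Db).
        intros t. rewrite normR2_sym. reflexivity.
Qed.
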